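(* Assume that $T^\#T$ and $V^\#V$ are indefinite operators on $\mathcal{H}$ and that $N(T)\cap N(V)=\{0\}$. The following conditions are equivalent: (i) $\mathcal{Z}(w,z)\neq\varnothing$ for every $(w,z)\in\mathcal{K}\times\mathcal{E}$; (ii) there exists $\alpha>0$ such that $[Ty,Ty]_{\mathcal{K}}\geq\alpha\|y\|^2$ for every $y\in\mathcal{C}_V$, and $$\sup_{x\in\mathcal{P}^-(V)}\frac{[Tx,Tx]_{\mathcal{K}}}{[Vx,Vx]_{\mathcal{E}}}\quad\text{and}\quad\inf_{x\in\mathcal{P}^+(V)}\frac{[Tx,Tx]_{\mathcal{K}}}{[Vx,Vx]_{\mathcal{E}}}$$ are attained.
   Context: $(\mathcal{H},\langle\cdot,\cdot\rangle)$ is a complex separable Hilbert space, $(\mathcal{K},[\cdot,\cdot]_{\mathcal{K}})$ and $(\mathcal{E},[\cdot,\cdot]_{\mathcal{E}})$ are complex Krein spaces (boundedness of operators and topologies refer to the norm of any associated Hilbert space). $T:\mathcal{H}\to\mathcal{K}$ is a bounded linear operator with closed range and $V:\mathcal{H}\to\mathcal{E}$ is a bounded linear surjective operator; $N(\cdot)$ denotes the nullspace. $T^\#:\mathcal{K}\to\mathcal{H}$ and $V^\#:\mathcal{E}\to\mathcal{H}$ denote the adjoints, determined by $[Tx,w]_{\mathcal{K}}=\langle x,T^\#w\rangle$ and $[Vx,z]_{\mathcal{E}}=\langle x,V^\#z\rangle$ for all $x\in\mathcal H$, $w\in\mathcal K$, $z\in\mathcal E$. A selfadjoint operator on $\mathcal{H}$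 is indefinite if it is neither positive nor negative semidefinite. $\mathcal{C}_V=\{y\in\mathcal{H}: [Vy,Vy]_{\mathcal{E}}=0\}$, $\mathcal{P}^+(V)=\{x\in\mathcal{H}:[Vx,Vx]_{\mathcal{E}}>0\}$, $\mathcal{P}^-(V)=\{x\in\mathcal{H}:[Vx,Vx]_{\mathcal{E}}<0\}$. For $(w,z)\in\mathcal{K}\times\mathcal{E}$, $\mathcal{Z}(w,z)$ is the set of vectors at which the minimum of $[Tx-w,Tx-w]_{\mathcal{K}}$ over $\{x\in\mathcal{H}:[Vx-z,Vx-z]_{\mathcal{E}}=0\}$ is attained (empty if the minimum does not exist). *)

(* Defs.v *)
From HB Require Import structures.
From mathcomp Require Import all_boot all_order all_algebra.
From mathcomp Require Import all_classical all_reals all_analysis.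
From mathcomp Require Export sesquilinear complex.

Set Implicit Arguments.
Unset Strict Implicit.
Unset Printing Implicit Defensive.

Import Order.TTheory GRing.Theory Num.Theory Num.Def.
Import numFieldNormedType.Exports.

Local Open Scope classical_set_scope.
Local Open Scope ring_scope.

(* Scalars are R[i] with R : realType. In R[i], x <= y means that y - x is a
   nonnegative real, so an inequality between values f u u of a hermitian form
   f, which are real, is the usual one. Forms are linear in the first argument
   and conjugate-linear in the second; {hermitian_sym U for conjC} is the type
   of hermitian forms and {dot U for conjC} that of positive definite ones. *)

Section Spaces.
Variables (R : realType) (U : completeNormedModType R[i]).

(* Completeness is part of the type of U. *)
Definition hilbert_space (f : {dot U for conjC}) : Prop :=
  forall x : U, `|x| ^+ 2 = f x x.

Definition separable : Prop :=
  exists2 D : set U, countable D & dense D.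

(* U = Up [+] Um, with f positive definite on Up and negative definite on Um;
   the norm of U is the one of the associated Hilbert space, with inner product
   f x_+ y_+ - f x_- y_-. For this norm Up and Um are closed, so completeness
   of U says precisely that (Up, f) and (Um, -f) are Hilbert spaces. *)
Definition fundamental_decomposition (f : {hermitian_sym U for conjC})
    (Up Um : set U) : Prop :=
  [/\ submod_closed (mem Up) /\ submod_closed (mem Um),
      Up `&` Um = [set 0],
      (forall x, exists xp xm, [/\ Up xp, Um xm & x = xp + xm]),
      (forall xp xm, Up xp -> Um xm -> f xp xm = 0) &
      (forall xp xm, Up xp -> Um xm ->
         `|xp + xm| ^+ 2 = f xp xp - f xm xm)].

(* The norms associated with two fundamental decompositions of a Krein space
   are equivalent, so boundedness and closedness do not depend on which of them
   U carries. *)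
Definition krein_space (f : {hermitian_sym U for conjC}) : Prop :=
  exists Up Um : set U, fundamental_decomposition f Up Um.

End Spaces.

Section Operators.
Variables (R : realType) (H K : completeNormedModType R[i]).

Definition bounded_operator (T : {linear H -> K}) : Prop :=
  exists M : R, forall x : H, `|T x| <= M%:C%C * `|x|.

Definition nullspace (T : {linear H -> K}) : set H := [set x | T x = 0].

Definition is_adjoint (ip : {dot H for conjC})
    (f : {hermitian_sym K for conjC}) (T : {linear H -> K}) (Ts : K -> H) :
    Prop :=
  forall (x : H) (w : K), f (T x) w = ip x (Ts w).

Definition positive_semidefinite (ip : {dot H for conjC}) (A : H -> H) : Prop :=
  forall x, 0 <= ip (A x) x.

Definition negative_semidefinite (ip : {dot H for conjC}) (A : H -> H) : Prop :=
  forall x, ip (A x) x <= 0.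

Definition indefinite (ip : {dot H for conjC}) (A : H -> H) : Prop :=
  ~ positive_semidefinite ip A /\ ~ negative_semidefinite ip A.

Definition C_set (f : {hermitian_sym K for conjC}) (V : {linear H -> K}) :
  set H := [set y | f (V y) (V y) = 0].

Definition P_plus (f : {hermitian_sym K for conjC}) (V : {linear H -> K}) :
  set H := [set x | 0 < f (V x) (V x)].

Definition P_minus (f : {hermitian_sym K for conjC}) (V : {linear H -> K}) :
  set H := [set x | f (V x) (V x) < 0].

End Operators.

Section Problem.
Variables (R : realType) (H K E : completeNormedModType R[i]).
Variables (fK : {hermitian_sym K for conjC}) (fE : {hermitian_sym E for conjC}).
Variables (T : {linear H -> K}) (V : {linear H -> E}).

Definition constraint_set (z : E) : set H :=
  [set x | fE (V x - z) (V x - z) = 0].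

Definition Z_set (w : K) (z : E) : set H :=
  [set x | constraint_set z x /\
     forall y, constraint_set z y ->
       fK (T x - w) (T x - w) <= fK (T y - w) (T y - w)].

Definition quotient (x : H) : R :=
  complex.Re (fK (T x) (T x) / fE (V x) (V x)).

End Problem.

(* The supremum and infimum are taken in \bar R, since mathcomp's sup and inf
   are 0 on unbounded sets of reals. *)
Definition sup_attained (R : realType) (X : Type) (A : set X) (g : X -> R) :
    Prop :=
  exists2 x, A x & (g x)%:E = ereal_sup [set (g y)%:E | y in A].

Definition inf_attained (R : realType) (X : Type) (A : set X) (g : X -> R) :
    Prop :=
  exists2 x, A x & (g x)%:E = ereal_inf [set (g y)%:E | y in A].

(* Main.v *)
Require Import Defs.
From HB Require Import structures.
From mathcomp Require Import all_boot all_order all_algebra.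
From mathcomp Require Import all_classical all_reals all_analysis.
From mathcomp Require Import sesquilinear complex.
From mathcomp Require Import ring lra.

(** Shifting by a preimage of [z], condition (i) says that for every [w] the
function [a(y) - 2 Re [Ty, w]] attains its minimum on the cone [b = 0], where
[a(y) = [Ty, Ty]] and [b(y) = [Vy, Vy]]. Everything can be expressed with the
real parts of the forms, so we work with real symmetric bilinear forms.

(ii) => (i): let [l+] and [l-] be the attained infimum and supremum. By the
S-lemma [l- <= l+] and [a - l+ b], [a - l- b] are positive semidefinite. The
maximum of the two convex functions [a - l b - 2 Re [T., w]], [l = l+, l-], is
convex and coercive, agrees with the objective on the cone, and so has a
minimizer [x] in the whole space. If [b(x) < 0], moving [x] along a vector [v]
of the kernel of [a - l+ b] with [b(v) > 0] reaches the cone at the same value;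
similarly if [b(x) > 0].

(i) => (ii): boundedness below and the uniform boundedness principle give
[a(y) >= c |Ty|^2] on the cone, so by the S-lemma [g = a - l b >= c |T.|^2] for
some [l], with [l <> 0] since [a] is not positive semidefinite. As [V] is onto,
[g] dominates [|V.|^2] too, and the space is complete for [g]: the only
obstruction would be a sequence [k_n] in the nullspace of [V] with [T k_n -> w],
and (i) applied to [w] provides [y] in the cone with [Ty = w]. Completeness and
uniform boundedness make [g] coercive. If the infimum [m] of [a / b] on [b > 0]
were not attained, pick [x] with [b(x) < 0] such that [(a - m b)(., x)] has the
form [[T., w]]; on the cone the objective for [w] is [(a - m b)(y - x)] up to a
constant, with infimum [0], which is not attained. *)

Set Implicit Arguments.
Unset Strict Implicit.
Unset Printing Implicit Defensive.

Import Order.TTheory GRing.Theory Num.Theory Num.Def.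
Import numFieldNormedType.Exports.

Local Open Scope classical_set_scope.
Local Open Scope ring_scope.

(** * Real symmetric bilinear forms *)

Section Rate.
Variable R : realType.
Implicit Types a b c x C : R.

(** The common scale for limits: squared distances are bounded by a constant times [rate n], so
    convergence becomes a family of explicit inequalities. *)
Definition rate (n : nat) : R := n.+1%:R^-1.

Lemma rate_gt0 n : 0 < rate n.
Proof. by rewrite invr_gt0. Qed.

Lemma rate_le1 n : rate n <= 1.
Proof. by rewrite invf_le1// ler1n. Qed.

Lemma rate_anti m n : (m <= n)%N -> rate n <= rate m.
Proof. by move=> mn; rewrite lef_pV2 ?posrE// ler_nat. Qed.

Lemma rate_small C e : 0 < e -> exists n, C * rate n < e.
Proof.
move=> e0; exists (truncn (`|C| / e)).
have := truncnS_gt (`|C| / e); rewrite ltr_pdivrMr// => h.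
by rewrite /rate ltr_pdivrMr// (le_lt_trans (ler_norm C))// mulrC.
Qed.

Lemma le0_rate C x : (forall n, x <= C * rate n) -> x <= 0.
Proof.
move=> h; rewrite leNgt; apply/negP => x0.
by have [n] := rate_small C x0; rewrite ltNge h.
Qed.

Lemma quad_lead_ge0 a b c : (forall t, 0 <= t ^+ 2 * a + 2 * t * b + c) -> 0 <= a.
Proof.
move=> h; rewrite leNgt; apply/negP => a0.
(* Adding the values at [s] and [- s] cancels the linear term, and [s] is large enough to make
   [s ^+ 2 * a + c] negative. *)
pose s := `|c| / - a + 1.
have s1 : 1 <= s by rewrite lerDr divr_ge0// oppr_ge0 ltW.
have hs : s * - a = `|c| - a by rewrite mulrDl mul1r divfK// oppr_eq0 lt_eqF.
have hs2 : s ^+ 2 * a = - (s * (`|c| - a)) by rewrite -hs; ring.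
have : `|c| - a <= s * (`|c| - a).
  by rewrite ler_peMl// subr_ge0 (le_trans (ltW a0)).
by have := h s; have := h (- s); have := ler_norm c; rewrite sqrrN hs2; lra.
Qed.

Lemma quad_disc a b c :
  (forall t, 0 <= t ^+ 2 * a + 2 * t * b + c) -> b ^+ 2 <= a * c.
Proof.
move=> h; have a0 := quad_lead_ge0 h.
have c0 := h 0; rewrite expr0n/= !mul0r mulr0 mul0r !add0r in c0.
have [a00|an0] := eqVneq a 0.
  have [->|b0] := eqVneq b 0; first by rewrite expr0n/= mulr_ge0.
  have := h (- (c + 1) / (2 * b)); rewrite a00 mulr0 add0r.
  have -> : 2 * (- (c + 1) / (2 * b)) * b + c = -1 by field.
  lra.
have {}a0 : 0 < a by rewrite lt_neqAle eq_sym an0.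
have := h (- b / a).
have -> : (- b / a) ^+ 2 * a + 2 * (- b / a) * b + c = (a * c - b ^+ 2) / a by field.
by rewrite pmulr_lge0 ?invr_gt0// subr_ge0.
Qed.

Lemma sqr_le0_eq0 x : x ^+ 2 <= 0 -> x = 0.
Proof.
by move=> h; apply/eqP; rewrite -sqrf_eq0 eq_le h sqr_ge0.
Qed.

End Rate.

Section Forms.
Variable R : realType.

Record sform (X : lmodType R) := SForm {
  sform_fun :> X -> X -> R;
  sformC : forall x y, sform_fun x y = sform_fun y x;
  sformPl : forall t x y z,
    sform_fun (t *: x + y) z = t * sform_fun x z + sform_fun y z }.

Section Theory.
Variable X : lmodType R.
Implicit Types (f g h b : sform X) (x y z : X) (t C D : R).

Lemma sformDl f x y z : f (x + y) z = f x z + f y z.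
Proof. by have := sformPl f 1 x y z; rewrite scale1r mul1r. Qed.

Lemma sform0l f z : f 0 z = 0.
Proof. by have := sformDl f 0 0 z; rewrite addr0; lra. Qed.

Lemma sformZl f t x z : f (t *: x) z = t * f x z.
Proof. by have := sformPl f t x 0 z; rewrite addr0 sform0l addr0. Qed.

Lemma sformNl f x z : f (- x) z = - f x z.
Proof. by rewrite -scaleN1r sformZl mulN1r. Qed.

Lemma sformBl f x y z : f (x - y) z = f x z - f y z.
Proof. by rewrite sformDl sformNl. Qed.

Lemma sformDr f x y z : f z (x + y) = f z x + f z y.
Proof. by rewrite sformC sformDl !(sformC f z). Qed.

Lemma sform0r f z : f z 0 = 0.
Proof. by rewrite sformC sform0l. Qed.

Lemma sformZr f t x z : f z (t *: x) = t * f z x.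
Proof. by rewrite sformC sformZl (sformC f z). Qed.

Lemma sformNr f x z : f z (- x) = - f z x.
Proof. by rewrite sformC sformNl (sformC f z). Qed.

Lemma sformBr f x y z : f z (x - y) = f z x - f z y.
Proof. by rewrite sformDr sformNr. Qed.

Definition sformE := (sform0l, sform0r, sformBl, sformBr, sformDl, sformDr,
  sformZl, sformZr, sformNl, sformNr).

Lemma sformDD f x y : f (x + y) (x + y) = f x x + 2 * f x y + f y y.
Proof. by rewrite !sformE (sformC f y x); ring. Qed.

Lemma sformBB f x y : f (x - y) (x - y) = f x x - 2 * f x y + f y y.
Proof. by rewrite !sformE (sformC f y x); ring. Qed.

Lemma sformZZ f t x : f (t *: x) (t *: x) = t ^+ 2 * f x x.
Proof. by rewrite !sformE; ring. Qed.

Lemma sform_subC f x y : f (x - y) (x - y) = f (y - x) (y - x).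
Proof. by rewrite !sformE (sformC f y x); ring. Qed.

Fact sform_comb_symm (s t : R) f g x y :
  s * f x y + t * g x y = s * f y x + t * g y x.
Proof. by rewrite sformC (sformC g). Qed.

Fact sform_comb_lin (s t : R) f g r x y z :
  s * f (r *: x + y) z + t * g (r *: x + y) z =
  r * (s * f x z + t * g x z) + (s * f y z + t * g y z).
Proof. by rewrite !sformPl; ring. Qed.

Definition sform_comb (s : R) f (t : R) g : sform X :=
  SForm (sform_comb_symm s t f g) (sform_comb_lin s t f g).

Lemma sform_combE s f t g x y :
  sform_comb s f t g x y = s * f x y + t * g x y.
Proof. by []. Qed.

Definition psd f := forall x, 0 <= f x x.

Lemma psd_CS g x y : psd g -> g x y ^+ 2 <= g x x * g y y.
Proof.
move=> g0; apply: quad_disc => t.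
by have := g0 (t *: x + y); rewrite sformDD sformZZ sformZl mulrA.
Qed.

Lemma psd_addle g x y : psd g -> g (x + y) (x + y) <= 2 * g x x + 2 * g y y.
Proof. by move=> /(_ (x - y)); rewrite sformBB sformDD; lra. Qed.

Lemma psd_suble g x y z : psd g ->
  g (x - y) (x - y) <= 2 * g (x - z) (x - z) + 2 * g (y - z) (y - z).
Proof.
move=> g0; have -> : x - y = (x - z) + (z - y) by rewrite addrA subrK.
by rewrite (sform_subC g y); exact: psd_addle.
Qed.

Definition bounded_form g f :=
  exists2 D, 0 <= D & forall x y, f x y ^+ 2 <= D * (g x x * g y y).

(* Testing only sequences that are Cauchy at the rate [1 / n] is no restriction,
   since a Cauchy sequence has such a subsequence; [C] and [C'] absorb all
   constants. *)
Definition complete_form g := forall (u : nat -> X) C,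
  (forall m n, g (u m - u n) (u m - u n) <= C * (rate R m + rate R n)) ->
  exists x C', forall n, g (u n - x) (u n - x) <= C' * rate R n.

Lemma complete_form_equiv g h C C' : 0 <= C -> 0 <= C' ->
  (forall x, g x x <= C * h x x) -> (forall x, h x x <= C' * g x x) ->
  complete_form g -> complete_form h.
Proof.
move=> C0 C'0 gh hg cg u D uD.
have [m n|x [D' xD']] := cg u (C * D).
  by rewrite (le_trans (gh _))// -mulrA ler_wpM2l.
by exists x, (C' * D') => n; rewrite (le_trans (hg _))// -mulrA ler_wpM2l.
Qed.

Section Riesz.
Variables (g : sform X) (S : X -> Prop) (l : X -> R) (C : R).
Hypotheses (g0 : psd g) (cg : complete_form g).
Hypotheses (S0 : S 0) (SP : forall t x y, S x -> S y -> S (t *: x + y)).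
Hypothesis (lP : forall t x y, l (t *: x + y) = t * l x + l y).
Hypothesis (lC : forall x, S x -> l x ^+ 2 <= C * g x x).

Let f s := g s s - 2 * l s.

Let f_lb : exists m, forall s, S s -> m <= f s.
Proof.
exists (- `|C|) => s Ss; rewrite leNgt; apply/negP; rewrite /f => h.
have h1 : l s ^+ 2 <= `|C| * g s s.
  by rewrite (le_trans (lC Ss))// ler_wpM2r// ler_norm.
have := g0 s; have := normr_ge0 C; move: h h1.
move: `|C| (g s s) (l s) => c p q h h1 c0 p0.
have : 0 < (2 * q - (p + c)) * (2 * q + (p + c)) by apply: mulr_gt0; lra.
by have := sqr_ge0 (p - c); lra.
Qed.

(** A minimizing sequence of [f] on [S] is Cauchy by the parallelogram law; its limit, in the
    closure of [S], represents [l] by stationarity. With [l := g x] this is the orthogonal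
    projection onto that closure. *)
Lemma riesz_closure : exists x (u : nat -> X) C',
  [/\ forall n, S (u n),
      forall n, g (u n - x) (u n - x) <= C' * rate R n &
      forall s, S s -> g x s = l s].
Proof.
have [b bf] := f_lb.
pose A := [set f s | s in S]; pose m := inf A.
have hA : has_inf A.
  split; first by exists (f 0), 0.
  by exists b => _ [s Ss <-]; exact: bf.
have mf s : S s -> m <= f s.
  by move=> Ss; apply: ge_inf; [exact: hA.2|exists s].
have /choice[u hu] n : exists s, S s /\ f s <= m + rate R n.
  have [_ [s Ss <-] h] := inf_adherent (rate_gt0 R n) hA.
  by exists s; split => //; exact: ltW.
have lD x y : l (x + y) = l x + l y.
  by have := lP 1 x y; rewrite scale1r mul1r.
have l0 : l 0 = 0 by have := lD 0 0; rewrite addr0; lra.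
have lZ t x : l (t *: x) = t * l x.
  by have := lP t x 0; rewrite addr0 l0 addr0.
have SZ t x : S x -> S (t *: x).
  by move=> Sx; have := SP t Sx S0; rewrite addr0.
have [p q|x [D xD]] := cg (u := u) (C := 2).
  have Smid : S (2^-1 *: u p + 2^-1 *: u q).
    by apply: SP; [exact: (hu _).1|apply: SZ; exact: (hu _).1].
  have := mf _ Smid; have := (hu p).2; have := (hu q).2.
  rewrite /f lD !lZ sformBB sformDD !sformZZ !sformE.
  by set U := g _ _; set V := g _ _; set W := g _ _; lra.
exists x, u, D; split => [n|//|s Ss]; first exact: (hu n).1.
have D0 : 0 <= D.
  have := xD 0%N; have := g0 (u 0%N - x); rewrite /rate invr1; lra.
apply/eqP; rewrite -subr_eq0; apply/eqP/sqr_le0_eq0.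
apply: (@le0_rate _ (2 * (1 + D) * g s s)) => n.
(* As [u n] is minimal up to [rate R n], [f (t *: s + u n) - f (u n) + rate R n] is a nonnegative
   polynomial in [t]. *)
have h1 : (g (u n) s - l s) ^+ 2 <= g s s * rate R n.
  apply: quad_disc => t; have := mf _ (SP t Ss (hu n).1).
  have := (hu n).2; rewrite /f lP sformDD sformZZ !sformE (sformC g s (u n)).
  by lra.
have h2 : (g (u n) s - g x s) ^+ 2 <= g s s * (D * rate R n).
  rewrite -sformBl (le_trans (psd_CS _ _ g0))// mulrC ler_wpM2l//.
have -> : g x s - l s = (g (u n) s - l s) - (g (u n) s - g x s) by ring.
move: (g (u n) s - l s) (g (u n) s - g x s) h1 h2 => p q p2 q2.
by have := sqr_ge0 (p + q); lra.
Qed.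

End Riesz.

Lemma riesz g (l : X -> R) C : psd g -> complete_form g ->
  (forall t x y, l (t *: x + y) = t * l x + l y) ->
  (forall x, l x ^+ 2 <= C * g x x) ->
  exists x, forall s, g x s = l s.
Proof.
move=> g0 cg lP lC.
have [//|//|//|x [_ [_ [_ _ h]]]] :=
  @riesz_closure g (fun=> True) l C g0 cg _ _ lP.
by exists x => s; exact: h.
Qed.

Lemma quad_limit g b (l : X -> R) D (u : nat -> X) x C C' m :
  psd g -> bounded_form g b ->
  (forall x y, l (x + y) = l x + l y) -> (forall x, l x ^+ 2 <= D * g x x) ->
  (forall n, g (u n - x) (u n - x) <= C * rate R n) ->
  (forall n, b (u n) (u n) + l (u n) <= m + C' * rate R n) ->
  b x x + l x <= m.
Proof.
move=> g0 [B B0 hB] lD lB uC hm; rewrite leNgt; apply/negP => hlt.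
pose e := b x x + l x - m; have e0 : 0 < e by rewrite subr_gt0.
have C0 : 0 <= C.
  have := uC 0%N; have := g0 (u 0%N - x); rewrite /rate invr1; lra.
(* The excess [e] is at most a sum of four terms with squares of order [rate R n]; the outer 4 is
   Cauchy-Schwarz on that sum. *)
pose K := 4 * (4 * B * g x x * C + `|D| * C + B * C ^+ 2 + C' ^+ 2).
have [n] := rate_small K (exprn_gt0 2 e0).
pose d := u n - x.
have un : u n = x + d by rewrite addrC subrK.
have := uC n; have := hm n; rewrite -/d un sformDD lD.
have := rate_gt0 R n; have := rate_le1 R n; set r := rate R n => r1 r0 h1 h2.
have gx := g0 x; have gd := g0 d.
have p1 : b x d ^+ 2 <= B * g x x * C * r.
  rewrite (le_trans (hB _ _))// -2!mulrA ler_wpM2l// ler_wpM2l//.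
have p2 : l d ^+ 2 <= `|D| * C * r.
  rewrite (le_trans (lB _))// -mulrA.
  rewrite (@le_trans _ _ (`|D| * g d d))// ?ler_wpM2r ?ler_norm//.
  by rewrite ler_wpM2l.
have p3 : b d d ^+ 2 <= B * C ^+ 2 * r.
  rewrite (le_trans (hB _ _))// -mulrA ler_wpM2l//.
  apply: (@le_trans _ _ ((C * r) * (C * r))); first exact: ler_pM.
  have : 0 <= C ^+ 2 * r * (1 - r).
    by rewrite mulr_ge0 ?subr_ge0// mulr_ge0 ?sqr_ge0// ltW.
  by lra.
have p4 : (C' * r) ^+ 2 <= C' ^+ 2 * r.
  have : 0 <= C' ^+ 2 * r * (1 - r).
    by rewrite mulr_ge0 ?subr_ge0// mulr_ge0 ?sqr_ge0// ltW.
  by rewrite exprMn; lra.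
have h3 : e <= C' * r - 2 * b x d - b d d - l d by rewrite /e; lra.
rewrite ltNge => /negP; apply.
apply: (@le_trans _ _ ((C' * r - 2 * b x d - b d d - l d) ^+ 2)).
  by rewrite lerXn2r// nnegrE// ltW// (lt_le_trans e0).
move: p1 p2 p3 p4; rewrite /K; move: (C' * r) (b x d) (b d d) (l d) => p q s t.
move=> p1 p2 p3 p4.
have : 0 <= (p + 2 * q) ^+ 2 + (p + s) ^+ 2 + (p + t) ^+ 2 + (2 * q - s) ^+ 2
   + (2 * q - t) ^+ 2 + (s - t) ^+ 2 by rewrite !addr_ge0 ?sqr_ge0.
by lra.
Qed.

End Theory.
End Forms.

(** * Minimization and uniform boundedness *)

Section Minimization.
Variables (R : realType) (X : lmodType R).
Variables (g : sform X) (f : X -> R).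
Hypotheses (g0 : psd g) (cg : complete_form g).
Hypothesis f_lb : exists m, forall x, m <= f x.
Hypothesis f_coercive : forall v, exists D, forall x, f x <= v -> g x x <= D.
Hypothesis f_qconvex : forall v x y, f x <= v -> f y <= v ->
  f (2^-1 *: (x + y)) <= v.
Hypothesis f_closed : forall (u : nat -> X) x C m,
  (forall n, g (u n - x) (u n - x) <= C * rate R n) ->
  (forall n, f (u n) <= m + rate R n) -> f x <= m.

(* The elements of almost minimal norm of the decreasing sublevel sets
   [f <= inf f + rate n] form a Cauchy sequence, by the parallelogram law;
   this replaces weak compactness. *)
Lemma convex_min : exists x, forall y, f x <= f y.
Proof.
have [b bf] := f_lb.
pose A := range f; pose m := inf A.
have hA : has_inf A by split; [exists (f 0), 0|exists b => _ [s _ <-]].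
have mf s : m <= f s by apply: ge_inf; [exact: hA.2|exists s].
pose S n := [set g x x | x in [set x | f x <= m + rate R n]].
have [D hD] := f_coercive (m + 1).
have hS n : has_inf (S n).
  split; last by exists 0 => _ [s _ <-].
  have [_ [s _ <-] h] := inf_adherent (rate_gt0 R n) hA.
  by exists (g s s), s => //=; exact: ltW.
have Sle n x : f x <= m + rate R n -> inf (S n) <= g x x.
  by move=> h; apply: ge_inf; [exact: (hS n).2|exists x].
pose B := range (fun n => inf (S n)).
have hB : has_sup B.
  split; first by exists (inf (S 0%N)), 0%N.
  exists D => _ [n _ <-].
  have [_ [s hs _]] := (hS n).1.
  by rewrite (le_trans (Sle _ _ hs))// hD// (le_trans hs)// lerD2l rate_le1.
pose r := sup B.
have rB n : inf (S n) <= r by apply: ub_le_sup; [exact: hB.2|exists n].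
have Santi p q : (p <= q)%N -> inf (S p) <= inf (S q).
  move=> pq; apply: lb_le_inf; first exact: (hS q).1.
  move=> _ [x hx <-]; apply: Sle; rewrite (le_trans hx)// lerD2l.
  exact: rate_anti.
(* [N n] is far enough for the infimum over the sublevel set to be within [rate R n] of its limit
   [r], and beyond [n] so that [f] still tends to [m]. *)
have /choice[N hN] n : exists k, (n <= k)%N /\ r - rate R n <= inf (S k).
  have [_ [k _ <-] hk] := sup_adherent (rate_gt0 R n) hB.
  exists (maxn n k); rewrite leq_maxl; split => //.
  by rewrite (le_trans (ltW hk))// Santi// leq_maxr.
have /choice[u hu] n : exists x, f x <= m + rate R (N n) /\ g x x <= r + rate R n.
  have [_ [x hx <-] h] := inf_adherent (rate_gt0 R n) (hS (N n)).
  by exists x; split => //; rewrite (le_trans (ltW h))// lerD2r.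
have mid p q : (N p <= N q)%N ->
    g (u p - u q) (u p - u q) <= 8 * (rate R p + rate R q).
  move=> pq.
  have /Sle : f (2^-1 *: (u p + u q)) <= m + rate R (N p).
    apply: f_qconvex; first exact: (hu p).1.
    by rewrite (le_trans (hu q).1)// lerD2l rate_anti.
  rewrite sformZZ sformBB sformDD; have := (hN p).2.
  have := (hu p).2; have := (hu q).2; have := rate_gt0 R p.
  have := rate_gt0 R q; lra.
have [p q|x [C hC]] := cg (u := u) (C := 8).
  have [/mid//|/ltnW/mid] := leqP (N p) (N q).
  by rewrite sform_subC (addrC (rate R q)).
exists x => y; apply: le_trans (mf y); apply: f_closed hC _ => n.
by rewrite (le_trans (hu n).1)// lerD2l rate_anti// (hN n).1.
Qed.

End Minimization.

Section UniformBound.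
Variables (R : realType) (Y : lmodType R) (g : sform Y).
Hypotheses (g0 : psd g) (cg : complete_form g).

Let nrm x := Num.sqrt (g x x).

Let nrm2 x : nrm x ^+ 2 = g x x.
Proof. by rewrite sqr_sqrtr// g0. Qed.

Let nrm_ge0 x : 0 <= nrm x.
Proof. exact: sqrtr_ge0. Qed.

Let abs_CS x y : `|g x y| <= nrm x * nrm y.
Proof.
rewrite -(@ler_pXn2r _ 2)// ?nnegrE ?mulr_ge0//.
by rewrite real_normK ?num_real// exprMn !nrm2 psd_CS.
Qed.

Let nrmD x y : nrm (x + y) <= nrm x + nrm y.
Proof.
rewrite -(@ler_pXn2r _ 2)// ?nnegrE ?addr_ge0//.
rewrite nrm2 sformDD sqrrD !nrm2.
by have := abs_CS x y; have := ler_norm (g x y); lra.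
Qed.

Let nrmZ t x : nrm (t *: x) = `|t| * nrm x.
Proof. by rewrite /nrm sformZZ sqrtrM ?sqr_ge0// sqrtr_sqr. Qed.

(** A gliding hump. If the family were unbounded, pick terms [K n] of norm at least [n.+1 / s n] and
    sum vectors [e n] of norm [s n] along them, with signs that reinforce the pairing; the limit [x]
    would pair with the [K n] unboundedly. *)
Lemma uniform_bound (I : Type) (k : I -> Y) :
  (forall w, exists C, forall i, `|g (k i) w| <= C) ->
  exists C, forall i, g (k i) (k i) <= C.
Proof.
move=> ptw; apply: contrapT => /forallNP nb.
pose s n : R := 4^-1 ^+ n.
have s0 n : 0 < s n by rewrite exprn_gt0// invr_gt0.
have sS n : s n.+1 = s n / 4 by rewrite /s exprSr.
have /choice[i hi] n : exists i, n.+1%:R / s n <= nrm (k i).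
  have /existsNP[i /negP] := nb ((n.+1%:R / s n) ^+ 2).
  rewrite -ltNge -nrm2 => h; exists i.
  rewrite -(@ler_pXn2r _ 2) ?nnegrE ?sqrtr_ge0 ?divr_ge0 ?(ltW (s0 n)) ?ler0n //.
  exact: ltW.
pose K n := k (i n).
have K0 n : 0 < nrm (K n) by apply: lt_le_trans (hi n); rewrite divr_gt0.
pose e n (w : Y) := (s n / nrm (K n) * (if 0 <= g (K n) w then 1 else -1)) *: K n.
pose w := fix w n := if n is p.+1 then w p + e p (w p) else 0.
have wS n : w n.+1 = w n + e n (w n) by [].
have ne n v : nrm (e n v) = s n.
  rewrite nrmZ normrM; set c := if _ then _ else _.
  have -> : `|c| = 1 by rewrite /c; case: ifP; rewrite ?normrN normr1.
  by rewrite mulr1 ger0_norm ?divr_ge0 ?ltW// divfK// gt_eqF.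
have ge n : s n * nrm (K n) <= `|g (K n) (w n.+1)|.
  rewrite wS sformDr sformZr -nrm2 expr2.
  set c := if _ then _ else _.
  have -> : s n / nrm (K n) * c * (nrm (K n) * nrm (K n)) = c * (s n * nrm (K n)).
    by field; rewrite gt_eqF.
  have p0 : 0 <= s n * nrm (K n) by rewrite mulr_ge0// ltW.
  rewrite /c; case: (leP 0 (g (K n) (w n))) => h.
    by rewrite mul1r ger0_norm ?addr_ge0// lerDr.
  by rewrite mulN1r ltr0_norm; lra.
have wd m n : nrm (w (n + m)%N - w n) <= 4 / 3 * (s n - s (n + m)%N).
  elim: m => [|m IH].
    by rewrite addn0 !subrr mulr0 /nrm sform0l sqrtr0.
  rewrite addnS wS addrAC (le_trans (nrmD _ _))// ne sS.
  by rewrite (le_trans (lerD IH (lexx _)))//; lra.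
have wd' m n : nrm (w (n + m)%N - w n) <= 4 / 3 * s n.
  by rewrite (le_trans (wd m n))// ler_wpM2l// gerBl ltW.
have s_rate n : s n ^+ 2 <= rate R n.
  have h : n.+1%:R <= 16 ^+ n :> R.
    elim: n => [|n IH]; first by rewrite expr0.
    rewrite exprS -natr1; have : 1 <= n.+1%:R :> R by rewrite ler1n.
    by lra.
  have -> : s n ^+ 2 = (16 ^+ n)^-1.
    by rewrite /s -exprM mulnC exprM -exprVn; congr (_ ^+ _); field.
  by rewrite lef_pV2// ?posrE ?exprn_gt0.
have [m n|x [C hC]] := cg (u := w) (C := 16 / 9).
  wlog mn : m n / (n <= m)%N.
    move=> h; have [|/ltnW] := leqP n m; first exact: h.
    by move=> /h; rewrite sform_subC (addrC (rate R n)).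
  rewrite -(subnKC mn) -nrm2.
  have h : nrm (w (n + (m - n))%N - w n) ^+ 2 <= (4 / 3 * s n) ^+ 2.
    by rewrite ler_pXn2r ?nnegrE ?sqrtr_ge0 ?mulr_ge0 ?(ltW (s0 n)).
  by have := s_rate n; have := rate_gt0 R (n + (m - n)); lra.
have C0 : 0 <= C.
  have := hC 0%N; have := g0 (w 0%N - x); rewrite /rate invr1; lra.
have wx n : nrm (w n - x) <= 4 / 3 * s n.
  rewrite leNgt; apply/negP => h.
  pose d := nrm (w n - x) - 4 / 3 * s n.
  have d0 : 0 < d by rewrite subr_gt0.
  have [p hp] := rate_small C (exprn_gt0 2 d0).
  have h1 : nrm (w (n + p)%N - x) < d.
    rewrite -(@ltr_pXn2r _ 2) ?nnegrE ?sqrtr_ge0 ?(ltW d0)// nrm2.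
    rewrite (le_lt_trans (hC _))// (le_lt_trans _ hp)// ler_wpM2l// rate_anti//.
    exact: leq_addl.
  have h2 : nrm (w n - w (n + p)%N) <= 4 / 3 * s n.
    by have := wd' p n; rewrite /nrm sform_subC.
  have := nrmD (w n - w (n + p)%N) (w (n + p)%N - x).
  by rewrite addrA subrK; move: h1 h2; rewrite /d; lra.
have [D hD] := ptw x.
have [n hn] : exists n, D < 2 / 3 * n.+1%:R.
  exists (truncn (3 / 2 * D)); have := truncnS_gt (3 / 2 * D); lra.
have := hD (i n); apply/negP; rewrite -ltNge (lt_le_trans hn)//.
(* The tail after [w n.+1] has norm at most [4 / 3 * s n.+1 = s n / 3], so it takes away at most a
   third of the bound in [ge]. *)
have h1 := ge n; have h2 := abs_CS (K n) (w n.+1 - x).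
have h3 : nrm (K n) * nrm (w n.+1 - x) <= nrm (K n) * (s n / 3).
  by rewrite ler_wpM2l// (le_trans (wx _))// sS; lra.
have h4 : `|g (K n) (w n.+1)| <= `|g (K n) x| + `|g (K n) (w n.+1 - x)|.
  by rewrite sformBr (le_trans _ (ler_normD _ _))// addrC subrK.
have h5 : n.+1%:R <= s n * nrm (K n) by rewrite mulrC -ler_pdivrMr.
by rewrite -/(K n); lra.
Qed.

End UniformBound.

(** * Sign of a form on the isotropic cone of another, and Krein spaces *)

Section Sign.
Variables (R : realType) (X : lmodType R).
Implicit Types (a b : sform X) (x y : X).

(** Along the line [b] is a quadratic polynomial in [t] whose roots have the negative product
    [b x x / b y y], so they are real and of opposite signs. *)
Lemma isotropic_line b x y : b x x * b y y < 0 -> exists t1 t2,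
  [/\ t1 < 0, 0 < t2, t1 * t2 * b y y = b x x,
      b (x + t1 *: y) (x + t1 *: y) = 0 & b (x + t2 *: y) (x + t2 *: y) = 0].
Proof.
move=> xy; have y0 : b y y != 0.
  by apply: contraTneq xy => ->; rewrite mulr0 ltxx.
pose p := b x y / b y y; pose r := p ^+ 2 - b x x / b y y.
have pr : p ^+ 2 < r.
  have -> : r = p ^+ 2 - b x x * b y y / b y y ^+ 2 by rewrite /r; field.
  by rewrite ltrDl oppr_gt0 pmulr_llt0// invr_gt0 exprn_even_gt0.
have r0 : 0 <= r by rewrite (le_trans _ (ltW pr))// sqr_ge0.
pose q := Num.sqrt r; have qr : q ^+ 2 = r by rewrite sqr_sqrtr.
have pq : `|p| < q.
  by rewrite -(@ltr_pXn2r _ 2) ?nnegrE ?sqrtr_ge0// real_normK ?num_real// qr.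
have root t : (t + p) ^+ 2 = r -> b (x + t *: y) (x + t *: y) = 0.
  move=> tr; rewrite sformDD sformZZ sformZr.
  have -> : b x x + 2 * (t * b x y) + t ^+ 2 * b y y =
      ((t + p) ^+ 2 - r) * b y y by rewrite /r /p; field.
  by rewrite tr subrr mul0r.
have := ler_norm p; have := ler_norm (- p); rewrite normrN => h1 h2.
exists (- p - q), (- p + q); split; [lra|lra| | |].
- have -> : (- p - q) * (- p + q) = p ^+ 2 - q ^+ 2 by ring.
  by rewrite qr /r; field.
- by apply: root; rewrite -qr; ring.
- by apply: root; rewrite -qr; ring.
Qed.

Lemma ratio_le a b x y : (forall z, b z z = 0 -> 0 <= a z z) ->
  0 < b x x -> b y y < 0 -> a y y / b y y <= a x x / b x x.
Proof.
move=> ab x0 y0.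
have [|t1 [t2 [t10 t20 h b1 b2]]] := @isotropic_line b x y.
  by rewrite pmulr_rlt0.
have := ab _ b1; have := ab _ b2; rewrite !sformDD !sformZZ !sformZr => h2 h1.
(* The positive weights [t2] and [- t1] cancel the cross term [a x y]. *)
have h3 : 0 <= (t2 - t1) * (a x x - t1 * t2 * a y y).
  have : 0 <= t2 * (a x x + 2 * (t1 * a x y) + t1 ^+ 2 * a y y).
    by rewrite mulr_ge0// ltW.
  have : 0 <= - t1 * (a x x + 2 * (t2 * a x y) + t2 ^+ 2 * a y y).
    by rewrite mulr_ge0// oppr_ge0 ltW.
  by lra.
rewrite ler_pdivlMr// mulrAC -h mulrA mulfK ?lt_eqF//.
rewrite pmulr_rge0 in h3; last by rewrite subr_gt0 (lt_trans t10).
by lra.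
Qed.

(** By [ratio_le] the supremum of [a / b] over [b < 0] is below every value over [b > 0]; it serves
    as the multiplier. *)
Lemma S_lemma a b : (exists x, 0 < b x x) -> (exists x, b x x < 0) ->
  (forall z, b z z = 0 -> 0 <= a z z) ->
  exists l, forall x, l * b x x <= a x x.
Proof.
move=> [xp xp0] [xm xm0] ab.
pose A := [set a x x / b x x | x in [set x | b x x < 0]].
have Aub x : 0 < b x x -> ubound A (a x x / b x x).
  by move=> x0 _ [y y0 <-]; exact: ratio_le.
have hA : has_sup A.
  by split; [exists (a xm xm / b xm xm), xm|exists (a xp xp / b xp xp); exact: Aub].
exists (sup A) => x; have [x0|x0|x0] := ltgtP (b x x) 0.
- by rewrite -ler_ndivrMr//; apply: ub_le_sup; [exact: hA.2|exists x].
- by rewrite -ler_pdivlMr//; apply: ge_sup; [exact: hA.1|exact: Aub].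
- by rewrite x0 mulr0 ab.
Qed.

End Sign.

Section Spaces.
Variable R : realType.

Definition definite (X : lmodType R) (g : sform X) :=
  forall x, g x x = 0 -> x = 0.

Definition hilbert (X : lmodType R) (g : sform X) :=
  [/\ psd g, definite g & complete_form g].

(* [f] is the indefinite inner product of a Krein space and [g] the inner
   product of an associated Hilbert space. *)
Definition krein (X : lmodType R) (g f : sform X) :=
  [/\ hilbert g, forall x y, f x y ^+ 2 <= g x x * g y y &
      forall y, exists y', forall x, g x y = f x y'].

Section Pull.
Variables (X Y : lmodType R) (f : sform Y) (T : {linear X -> Y}).

Fact pull_symm x y : f (T x) (T y) = f (T y) (T x).
Proof. exact: sformC. Qed.

Fact pull_lin t x y z :
  f (T (t *: x + y)) (T z) = t * f (T x) (T z) + f (T y) (T z).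
Proof. by rewrite linearP sformPl. Qed.

Definition pull : sform X := SForm pull_symm pull_lin.

Lemma pullE x y : pull x y = f (T x) (T y).
Proof. by []. Qed.

End Pull.

Lemma krein_abs (X : lmodType R) (g f : sform X) x :
  krein g f -> `|f x x| <= g x x.
Proof.
move=> [[g0 _ _] fg _].
rewrite -(@ler_pXn2r _ 2) ?nnegrE ?normr_ge0 ?g0//.
by rewrite real_normK ?num_real// fg.
Qed.

Lemma pull_bounded (X Y : lmodType R) (gX : sform X) (gY fY : sform Y)
    (T : {linear X -> Y}) : krein gY fY ->
  (exists2 C, 0 <= C & forall x, gY (T x) (T x) <= C * gX x x) ->
  bounded_form gX (pull fY T).
Proof.
move=> [[gY0 _ _] fgY _] [C C0 hC]; exists (C ^+ 2) => [|x y]; first exact: sqr_ge0.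
by rewrite pullE (le_trans (fgY _ _))// expr2 mulrACA ler_pM.
Qed.

Lemma krein_nondegenerate (X : lmodType R) (g f : sform X) x :
  krein g f -> (forall y, f x y = 0) -> x = 0.
Proof.
by move=> [[_ gd _] _ fd] x0; have [x' hx'] := fd x; apply: gd; rewrite hx'.
Qed.

Lemma le_of_sqr_le (p q : R) : 0 <= p -> 0 <= q -> p ^+ 2 <= p * q -> p <= q.
Proof.
move=> p0 q0; rewrite le_eqVlt in p0; case/predU1P : p0 => [<-//|p0].
by rewrite expr2 ler_pM2l.
Qed.

(** The uniform boundedness principle for the [L x] with [q x <= 1], extended by homogeneity. [D] is
    only closed under scaling, so that it may be the isotropic cone. *)
Lemma homogeneous_bound (X Y : lmodType R) (g f : sform Y) (D : X -> Prop)
    (L : X -> Y) (q : X -> R) : krein g f ->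
  (forall t x, D x -> D (t *: x)) -> (forall t x, L (t *: x) = t *: L x) ->
  (forall t x, q (t *: x) = t ^+ 2 * q x) -> (forall x, D x -> 0 <= q x) ->
  (forall w, exists C, forall x, D x -> f (L x) w ^+ 2 <= C * q x) ->
  exists2 C, 0 < C & forall x, D x -> g (L x) (L x) <= C * q x.
Proof.
move=> [[g0 _ gc] _ fd] DZ LZ qZ q0 ptw.
have [|C0 hC0] := @uniform_bound _ Y g g0 gc {x | D x /\ q x <= 1}
    (fun i => L (proj1_sig i)).
  move=> w; have [w' hw'] := fd w; have [C hC] := ptw w'.
  exists (1 + `|C|) => -[x [Dx qx]] /=; rewrite hw'.
  have h : f (L x) w' ^+ 2 <= `|C|.
    rewrite (le_trans (hC x Dx))// (le_trans (ler_norm _))// normrM.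
    by rewrite ler_piMr// ger0_norm// q0.
  have : `|f (L x) w'| ^+ 2 <= `|C| by rewrite real_normK ?num_real.
  have := sqr_ge0 (`|f (L x) w'| - 1); have := normr_ge0 (f (L x) w').
  by set p := `|f _ _|; lra.
pose C := `|C0| + 1; have C1 : 1 <= C by rewrite lerDr.
have hC t x : D x -> t ^+ 2 * q x <= 1 -> t ^+ 2 * g (L x) (L x) <= C.
  move=> Dx; rewrite -qZ => qx.
  have := hC0 (exist _ (t *: x) (conj (DZ t x Dx) qx)).
  by rewrite /= LZ sformZZ => /le_trans -> //; rewrite /C; have := ler_norm C0; lra.
exists C => [|x Dx]; first exact: lt_le_trans C1.
have := q0 x Dx; rewrite le_eqVlt => /predU1P[qx|qx].
  (* If [q x = 0], all multiples of [x] satisfy [q <= 1], and a large one violates the uniform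
     bound. *)
  rewrite -qx mulr0 leNgt; apply/negP => gx.
  have := hC (C / g (L x) (L x) + 1) x Dx; rewrite -qx mulr0 => /(_ ler01).
  apply/negP; rewrite -ltNge.
  have -> : (C / g (L x) (L x) + 1) ^+ 2 * g (L x) (L x) =
    C * (C / g (L x) (L x)) + 2 * C + g (L x) (L x) by field; rewrite gt_eqF.
  have : 0 <= C * (C / g (L x) (L x)) by rewrite mulr_ge0 ?divr_ge0//; lra.
  by lra.
have := hC (Num.sqrt (q x))^-1 x Dx; rewrite exprVn sqr_sqrtr ?(ltW qx)//.
rewrite mulVf ?gt_eqF// => /(_ (lexx _)).
by rewrite mulrC ler_pdivrMr.
Qed.

Section Adjoint.
Variables (X Y : lmodType R) (gX : sform X) (gY fY : sform Y).
Variables (T : {linear X -> Y}) (Ts : {linear Y -> X}).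
Hypotheses (hX : hilbert gX) (hY : krein gY fY).
Hypothesis bT : exists2 C, 0 <= C & forall x, gY (T x) (T x) <= C * gX x x.
Hypothesis adj : forall x w, fY (T x) w = gX x (Ts w).

Let gX0 : psd gX. Proof. by case: hX. Qed.
Let gY0 : psd gY. Proof. by case: hY => -[]. Qed.
Let fgY x y : fY x y ^+ 2 <= gY x x * gY y y. Proof. by case: hY. Qed.

Lemma adjoint_bounded :
  exists2 C, 0 <= C & forall w, gX (Ts w) (Ts w) <= C * gY w w.
Proof.
have [C C0 hC] := bT; exists C => // w.
apply: le_of_sqr_le; rewrite ?mulr_ge0//.
rewrite -{1}adj (le_trans (fgY _ _))// mulrCA mulrA.
by rewrite ler_wpM2r// mulrC.
Qed.

Hypothesis surjT : forall w, exists x, T x = w.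

(** Every [w] is some [T x], so its pairing with [e] is [gX x (Ts e)], which Cauchy-Schwarz bounds
    by the norm of [Ts e]; uniform boundedness concludes. *)
Lemma adjoint_bounded_below :
  exists2 C, 0 < C & forall w, gY w w <= C * gX (Ts w) (Ts w).
Proof.
have [//|//|t w|//||C C0 hC] := @homogeneous_bound Y Y gY fY (fun=> True) idfun
    (fun w => gX (Ts w) (Ts w)) hY.
- by rewrite linearZ sformZZ.
- by move=> w; have [x <-] := surjT w; exists (gX x x) => e _;
    rewrite sformC adj psd_CS.
by exists C => // w; exact: hC.
Qed.

(** Riesz representation in the complete form [h] gives [e] with [T (Ts e) = T y] and [Ts e]
    controlled by [T y]; take [u = y - Ts e]. *)
Lemma lift_bound : exists2 C, 0 <= C & forall y, exists u,
  T u = 0 /\ gX (y - u) (y - u) <= C * gY (T y) (T y).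
Proof.
have [C C0 hC] := adjoint_bounded_below; have [D D0 hD] := adjoint_bounded.
pose h := pull gX Ts.
have ch : complete_form h.
  apply: (@complete_form_equiv _ _ gY h C D (ltW C0) D0 hC hD).
  by case: hY => -[].
exists C => [|y]; first exact: ltW.
have h0 : psd h by move=> w; exact: gX0.
have hl w : fY (T y) w ^+ 2 <= C * gY (T y) (T y) * h w w.
  rewrite (le_trans (fgY _ _))// (mulrC C) -mulrA ler_wpM2l//; exact: hC.
have [t p q|e he] := riesz h0 ch _ hl; first by rewrite sformDr sformZr.
exists (y - Ts e); split.
  apply: (krein_nondegenerate hY) => w.
  by rewrite linearB sformBl (adj (Ts e)) -pullE he subrr.
rewrite opprB addrCA subrr addr0.
apply: le_of_sqr_le; rewrite ?mulr_ge0 ?(ltW C0)//.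
by have := hl e; rewrite -he mulrC.
Qed.

End Adjoint.
End Spaces.

(** * Existence of minima implies coercivity *)

Section Coercivity.
Variables (R : realType) (X Y Z : lmodType R).
Variables (gX : sform X) (gY fY : sform Y) (gZ fZ : sform Z).
Variables (T : {linear X -> Y}) (Ts : {linear Y -> X}).
Variables (V : {linear X -> Z}) (Vs : {linear Z -> X}).
Hypotheses (hX : hilbert gX) (hY : krein gY fY) (hZ : krein gZ fZ).
Hypothesis bT : exists2 C, 0 <= C & forall x, gY (T x) (T x) <= C * gX x x.
Hypothesis bV : exists2 C, 0 <= C & forall x, gZ (V x) (V x) <= C * gX x x.
Hypothesis adjT : forall x w, fY (T x) w = gX x (Ts w).
Hypothesis adjV : forall x w, fZ (V x) w = gX x (Vs w).
Hypothesis surjV : forall w, exists x, V x = w.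
Hypothesis kerTV : forall x, T x = 0 -> V x = 0 -> x = 0.

Let a := pull fY T.
Let b := pull fZ V.

Hypothesis a_neg : exists x, a x x < 0.
Hypothesis b_pos : exists x, 0 < b x x.
Hypothesis b_neg : exists x, b x x < 0.
Hypothesis minimum : forall w, exists2 y, b y y = 0 &
  forall x, b x x = 0 -> fY (T y - w) (T y - w) <= fY (T x - w) (T x - w).

Let gX0 : psd gX. Proof. by case: hX. Qed.
Let gY0 : psd gY. Proof. by case: hY => -[]. Qed.
Let fgY x y : fY x y ^+ 2 <= gY x x * gY y y. Proof. by case: hY. Qed.

Let cone t x : b x x = 0 -> b (t *: x) (t *: x) = 0.
Proof. by move=> x0; rewrite sformZZ x0 mulr0. Qed.

(** The cone contains all multiples of [x], so minimality of [y] yields a nonnegative polynomial in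
    [t]: its leading coefficient and its discriminant give the two bounds. *)
Let cone_bounds w : exists2 C, 0 <= C & forall x, b x x = 0 ->
  0 <= a x x /\ fY (T x) w ^+ 2 <= C * a x x.
Proof.
have [y y0 ymin] := minimum w.
pose C := fY w w - fY (T y - w) (T y - w).
have h x : b x x = 0 -> forall t,
    0 <= t ^+ 2 * a x x + 2 * t * - fY (T x) w + C.
  move=> x0 t; have := ymin _ (cone t x0).
  by rewrite linearZ [in X in _ <= X -> _]sformBB sformZZ sformZl /C pullE; lra.
exists C => [|x x0].
  by have := h 0 (sform0l _ _) 0; rewrite expr0n /= !mulr0 !mul0r !add0r.
split; first exact: quad_lead_ge0 (h x x0).
by rewrite -sqrrN mulrC; exact: quad_disc (h x x0).
Qed.

Let cone_lower : exists2 c, 0 < c &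
  forall x, b x x = 0 -> gY (T x) (T x) <= c * a x x.
Proof.
apply: (@homogeneous_bound _ _ _ gY fY (fun x => b x x = 0) T
  (fun x => a x x)) => //.
- by move=> t x; rewrite linearZ.
- by move=> t x; rewrite sformZZ.
- by move=> x x0; have [C _ h] := cone_bounds 0; exact: (h x x0).1.
- by move=> w; have [C _ h] := cone_bounds w; exists C => x x0; exact: (h x x0).2.
Qed.

Let multiplier : exists c l, [/\ 0 < c, l != 0 &
  forall x, gY (T x) (T x) <= c * (a x x - l * b x x)].
Proof.
have [c c0 hc] := cone_lower.
have [z z0|l hl] := @S_lemma _ _ (sform_comb 1 a (- c^-1) (pull gY T)) b b_pos b_neg.
  rewrite sform_combE pullE; have := hc z z0.
  by rewrite mulrC -ler_pdivrMr// mulNr mul1r mulrC subr_ge0.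
have h x : gY (T x) (T x) <= c * (a x x - l * b x x).
  have := hl x; rewrite sform_combE pullE mul1r mulNr -subr_ge0 => h.
  rewrite -subr_ge0.
  have -> : c * (a x x - l * b x x) - gY (T x) (T x) =
      c * (a x x - c^-1 * gY (T x) (T x) - l * b x x) by field; rewrite gt_eqF.
  by rewrite mulr_ge0// ltW.
exists c, l; split => //; apply/eqP => l0.
have [x ax] := a_neg; have := h x; rewrite l0 mul0r subr0.
have := gY0 (T x); have : c * a x x < 0 by rewrite pmulr_rlt0.
by lra.
Qed.

Section Multiplier.
Variables (c l : R).
Hypotheses (c0 : 0 < c) (l0 : l != 0).
Hypothesis hl : forall x, gY (T x) (T x) <= c * (a x x - l * b x x).

Let g := sform_comb 1 a (- l) b.

Let gE x y : g x y = a x y - l * b x y.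
Proof. by rewrite sform_combE mul1r mulNr. Qed.

Let hg x : gY (T x) (T x) <= c * g x x.
Proof. by rewrite gE. Qed.

Let g0 : psd g.
Proof. by move=> x; have := le_trans (gY0 (T x)) (hg x); rewrite pmulr_rge0. Qed.

(** The operator representing [g] in the Hilbert space, see [gG]. *)
Let G x := Ts (T x) - l *: Vs (V x).

Let G_linear : linear G.
Proof.
move=> t x y; rewrite /G (linearP T) (linearP Ts) (linearP V) (linearP Vs).
rewrite scalerDr scalerBr opprD addrACA.
by rewrite !scalerA [l * t]mulrC.
Qed.

HB.instance Definition _ := GRing.isLinear.Build R X X _ G G_linear.

Let gG x y : g x y = gX x (G y).
Proof. by rewrite gE /G !sformE !pullE adjT adjV. Qed.

Let g_le : exists2 C, 0 <= C & forall x, g x x <= C * gX x x.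
Proof.
have [C C0 hC] := bT; have [D D0 hD] := bV.
exists (C + `|l| * D) => [|x]; first by rewrite addr_ge0// mulr_ge0.
rewrite gE mulrDl lerD//.
  by rewrite (le_trans (ler_norm _))// (le_trans (krein_abs _ hY)).
rewrite (le_trans (ler_norm _))// normrN normrM -mulrA ler_wpM2l//.
by rewrite (le_trans (krein_abs _ hZ)).
Qed.

Let G_le : exists2 C, 0 <= C & forall x, gX (G x) (G x) <= C * g x x.
Proof.
have [C C0 hC] := g_le; exists C => // x.
apply: le_of_sqr_le; rewrite ?mulr_ge0//.
rewrite -{1}gG (le_trans (psd_CS _ _ g0))// mulrCA mulrA.
by rewrite ler_wpM2r// mulrC.
Qed.

(** [Vs] is bounded below because [V] is onto, and [l *: Vs (V x) = Ts (T x) - G x] with [l]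
    nonzero. *)
Let V_le : exists2 C, 0 <= C &
  forall x, gZ (V x) (V x) <= C * (gX (G x) (G x) + gY (T x) (T x)).
Proof.
have [C C0 hC] := adjoint_bounded_below hX hZ adjV surjV.
have [D D0 hD] := adjoint_bounded hX hY bT adjT.
exists (C * (l ^+ 2)^-1 * (2 + 2 * D)) => [|x].
  by rewrite !mulr_ge0 ?invr_ge0 ?sqr_ge0// ?(ltW C0)//; lra.
rewrite (le_trans (hC _))// -!mulrA ler_pM2l//.
rewrite ler_pdivlMl ?exprn_even_gt0// -sformZZ.
have -> : l *: Vs (V x) = Ts (T x) - G x by rewrite opprB addrCA subrr addr0.
rewrite (le_trans (psd_addle _ _ gX0))// (sformNl gX (G x)) (sformNr gX (G x)) opprK.
have := hD (T x); have := gX0 (G x); have := gY0 (T x).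
have : 0 <= D * gX (G x) (G x) by rewrite mulr_ge0.
by lra.
Qed.

Let V_le_g : exists2 C, 0 <= C & forall x, gZ (V x) (V x) <= C * g x x.
Proof.
have [C C0 hC] := V_le; have [D D0 hD] := G_le.
exists (C * (D + c)) => [|x]; first by rewrite mulr_ge0// addr_ge0// ltW.
by rewrite (le_trans (hC _))// -mulrA ler_wpM2l// mulrDl lerD.
Qed.

(* The limit of [T k], for a sequence [k] in the nullspace of [V] with [T k]
   Cauchy, is attained on the cone of [V]: take it as the [w] of [minimum]. *)
Let limit_attained (k : nat -> X) C w : (forall n, V (k n) = 0) ->
  (forall n, gY (T (k n) - w) (T (k n) - w) <= C * rate R n) ->
  exists x, forall n, g (k n - x) (k n - x) <= C * rate R n.
Proof.
move=> k0 kw; have [y y0 ymin] := minimum w.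
have bk n : b (k n) (k n) = 0 by rewrite pullE k0 sform0l.
have byk n : b (k n - y) (k n - y) = 0.
  by rewrite sformBB bk y0 !pullE k0 sform0l; lra.
have Ty0 : fY (T y - w) (T y - w) <= 0.
  apply: (@le0_rate _ C) => n; rewrite (le_trans (ymin _ (bk n)))//.
  by rewrite (le_trans _ (kw n))// (le_trans (ler_norm _))// krein_abs.
have [d d0 hd] := cone_lower.
have Tyw : T y = w.
  apply/eqP; rewrite -subr_eq0; apply/eqP; case: (hY) => -[_ defY _] _ _.
  apply: defY; apply/eqP; rewrite eq_le gY0 andbT.
  (* By [cone_lower], [q] is nonpositive at [T (y - k n)]; this passes to the limit [T y - w], where
     [Ty0] then forces [gY] to vanish. *)
  pose q := sform_comb 1 gY (- d) fY.
  suff : q (T y - w) (T y - w) + 0 <= 0.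
    rewrite addr0 sform_combE mul1r mulNr => h.
    have : d * fY (T y - w) (T y - w) <= 0 by rewrite pmulr_rle0.
    by lra.
  apply: (@quad_limit _ Y gY q (fun=> 0) 0 (fun n => T y - T (k n)) _ C 0) => //.
  - exists (2 + 2 * d ^+ 2) => [|u v].
      by rewrite addr_ge0// mulr_ge0// sqr_ge0.
    rewrite sform_combE; have := fgY u v; have := psd_CS u v gY0.
    move: (gY u v) (fY u v) (gY u u * gY v v) => p r s p2 r2.
    have := sqr_ge0 (p + d * r).
    have : d ^+ 2 * r ^+ 2 <= d ^+ 2 * s by rewrite ler_wpM2l ?sqr_ge0.
    by lra.
  - by move=> *; rewrite addr0.
  - by move=> x; rewrite expr0n /= mul0r.
  - move=> n; have -> : T y - T (k n) - (T y - w) = w - T (k n).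
      by rewrite opprB addrC addrA subrK.
    by rewrite sform_subC.
  - move=> n; rewrite mul0r !addr0 sform_combE mul1r mulNr subr_le0.
    by rewrite -linearB -pullE; apply: hd; rewrite sform_subC.
exists y => n; rewrite gE byk mulr0 subr0 pullE linearB Tyw.
by rewrite (le_trans _ (kw n))// (le_trans (ler_norm _))// krein_abs.
Qed.

(** [V (u n)] converges by [V_le_g], say to [V x]. [lift_bound] splits [u n - x] into a part tending
    to 0 and some [k n] in the nullspace of [V], which converges for [g] by [limit_attained]. *)
Let g_complete : complete_form g.
Proof.
move=> u C uC.
have gpos := g0; have [[_ _ cY] _ _] := hY; have [[_ _ cZ] _ _] := hZ.
have [D D0 hD] := V_le_g.
have [m n|z [C1 hz]] := cZ
    (fun n => V (u n)) (D * C).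
  by rewrite -linearB (le_trans (hD _))// -mulrA ler_wpM2l.
have [x xz] := surjV z; rewrite -{}xz in hz.
have [E E0 hE] := lift_bound hX hZ bV adjV surjV.
have /choice[k hk] n := hE (u n - x).
have hk0 n : V (k n) = 0 by case: (hk n).
have hk1 n : gX (u n - x - k n) (u n - x - k n) <= E * C1 * rate R n.
  rewrite (le_trans (hk n).2)// -mulrA ler_wpM2l// linearB.
  exact: hz.
have [F F0 hF] := g_le.
have hk2 n : g (u n - x - k n) (u n - x - k n) <= F * (E * C1) * rate R n.
  by rewrite (le_trans (hF _))// -mulrA ler_wpM2l.
have r0 n := rate_gt0 R n.
have hk3 m n : g (k m - k n) (k m - k n) <=
    (8 * (F * (E * C1)) + 4 * `|C|) * (rate R m + rate R n).
  have := psd_suble (k m) (k n) (u m - x) gpos.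
  have := psd_suble (k n) (u m - x) (u n - x) gpos.
  have := hk2 m; have := hk2 n.
  rewrite (sform_subC g _ (k n)) (sform_subC g _ (k m)).
  have -> : u m - x - (u n - x) = u m - u n by rewrite opprB addrA subrK.
  have := uC m n.
  have : C * (rate R m + rate R n) <= `|C| * (rate R m + rate R n).
    by rewrite ler_wpM2r ?ler_norm// addr_ge0// ltW.
  have : 0 <= F * (E * C1) * rate R m by apply: le_trans (hk2 m).
  have : 0 <= F * (E * C1) * rate R n by apply: le_trans (hk2 n).
  by lra.
have [m n|w [C2 hw]] := cY
    (fun n => T (k n)) (c * (8 * (F * (E * C1)) + 4 * `|C|)).
  by rewrite -linearB (le_trans (hg _))// -mulrA ler_pM2l.
have [y hy] := limit_attained hk0 hw.
exists (y + x), (2 * (F * (E * C1)) + 2 * C2) => n.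
have := psd_addle (u n - x - k n) (k n - y) gpos.
rewrite addrA subrK opprD addrA addrAC -addrA => /le_trans; apply.
by have := hk2 n; have := hy n; lra.
Qed.

(** Riesz representation in [g] writes [fY (T x) w] as [gX y (G x)], bounded by the norm of [G x];
    uniform boundedness applies. *)
Let T_le_G : exists2 C, 0 < C & forall x, gY (T x) (T x) <= C * gX (G x) (G x).
Proof.
have [||||w|C C0 hC] := @homogeneous_bound _ X Y gY fY (fun=> True) T
    (fun x => gX (G x) (G x)) hY.
- by [].
- by move=> t x; rewrite linearZ.
- by move=> t x; rewrite linearZ sformZZ.
- by [].
- have hw x : fY (T x) w ^+ 2 <= gY w w * c * g x x.
    by rewrite (le_trans (fgY _ _))// mulrC -mulrA ler_wpM2l.
  have [t p q|y hy] := riesz g0 g_complete _ hw.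
    by rewrite linearP sformPl.
  by exists (gX y y) => x _; rewrite -hy gG psd_CS.
by exists C => // x; exact: hC.
Qed.

(** As [g x x] is comparable with [gX (G x) (G x)], the latter form is complete; since [g] is
    definite by [kerTV], this makes [G] onto. With [x = G y], Cauchy-Schwarz on [gX x x = g x y]
    gives the bound. *)
Lemma g_coercive : exists2 e, 0 < e & forall x, e * gX x x <= g x x.
Proof.
have [C C0 hC] := T_le_G; have [D D0 hD] := V_le.
pose K := C + `|l| * (D * (1 + C)).
have K0 : 0 < K by rewrite ltr_wpDr// !mulr_ge0// addr_ge0// ltW.
have gK x : g x x <= K * gX (G x) (G x).
  rewrite gE mulrDl lerD//.
    by rewrite (le_trans (ler_norm _))// (le_trans (krein_abs _ hY)).
  rewrite (le_trans (ler_norm _))// normrN normrM -mulrA ler_wpM2l//.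
  rewrite (le_trans (krein_abs _ hZ))// (le_trans (hD _))// -mulrA ler_wpM2l//.
  by rewrite mulrDl mul1r lerD2l.
have gdef : definite g.
  move=> x gx; apply: kerTV; [case: (hY)|case: (hZ)] => -[p0 dp _] _ _; apply: dp.
    by apply/eqP; rewrite eq_le p0 andbT (le_trans (hg _))// gx mulr0.
  have [E E0 hE] := V_le_g.
  by apply/eqP; rewrite eq_le p0 andbT (le_trans (hE _))// gx mulr0.
pose h := pull gX G; have h0 : psd h by move=> x; exact: gX0.
have [E E0 hE] := G_le.
have ch : complete_form h.
  exact: (@complete_form_equiv _ _ g h K E (ltW K0) E0 gK hE g_complete).
exists K^-1 => [|x]; first by rewrite invr_gt0.
have hx u : gX x (G u) ^+ 2 <= gX x x * h u u by exact: psd_CS.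
have [t p q|y hy] := riesz h0 ch _ hx.
  by rewrite linearP sformDr sformZr.
have xy : x = G y.
  apply/eqP; rewrite -subr_eq0; apply/eqP; apply: gdef.
  by rewrite gG sformBl -hy pullE subrr.
rewrite ler_pdivrMl//; apply: le_of_sqr_le => //.
  by rewrite mulr_ge0// ltW.
have gxy : gX x x = g x y by rewrite gG -xy.
rewrite gxy (le_trans (psd_CS _ _ g0))//.
have := gK y; rewrite -xy gxy => hK.
rewrite (_ : g x y * _ = g x x * (K * g x y)) ?ler_wpM2l//.
by rewrite mulrC -mulrA mulrCA.
Qed.

End Multiplier.

Lemma coercive : exists e l, [/\ 0 < e, l != 0 &
  forall x, e * gX x x <= a x x - l * b x x].
Proof.
have [c [l [c0 l0 hl]]] := multiplier.
have [e e0 he] := g_coercive c0 l0 hl.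
exists e, l; split => // x.
by have := he x; rewrite sform_combE mul1r mulNr.
Qed.

End Coercivity.

(** * Existence of minima implies attainment *)

Section Attainment.
Variables (R : realType) (X Y : lmodType R).
Variables (gX : sform X) (gY fY : sform Y) (T : {linear X -> Y}) (b : sform X).
Hypotheses (hX : hilbert gX) (hY : krein gY fY).
Hypothesis bT : exists2 C, 0 <= C & forall x, gY (T x) (T x) <= C * gX x x.
Hypothesis bb : bounded_form gX b.

Let a := pull fY T.

Hypothesis a_neg : exists x, a x x < 0.
Hypothesis b_pos : exists x, 0 < b x x.
Hypothesis b_neg : exists x, b x x < 0.
Hypothesis minimum : forall w, exists2 y, b y y = 0 &
  forall x, b x x = 0 -> fY (T y - w) (T y - w) <= fY (T x - w) (T x - w).
Variables (e l : R).
Hypotheses (e0 : 0 < e) (l0 : l != 0).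
Hypothesis coerc : forall x, e * gX x x <= a x x - l * b x x.

Let gX0 : psd gX. Proof. by case: hX. Qed.
Let gY0 : psd gY. Proof. by case: hY => -[]. Qed.
Let fgY x y : fY x y ^+ 2 <= gY x x * gY y y. Proof. by case: hY. Qed.

Let g := sform_comb 1 a (- l) b.

Let gE x y : g x y = a x y - l * b x y.
Proof. by rewrite sform_combE mul1r mulNr. Qed.

Let g_ge x : gX x x <= e^-1 * g x x.
Proof. by rewrite ler_pdivlMl// gE. Qed.

Let g0 : psd g.
Proof. by move=> x; rewrite gE (le_trans _ (coerc x))// mulr_ge0// ltW. Qed.

Let bounded_abs : exists2 B, 0 <= B & forall x, `|b x x| <= B * gX x x.
Proof.
have [B B0 hB] := bb; exists (B + 1) => [|x]; first by rewrite addr_ge0.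
rewrite -(@ler_pXn2r _ 2) ?nnegrE ?mulr_ge0 ?addr_ge0//.
rewrite real_normK ?num_real// (le_trans (hB _ _))// exprMn -expr2.
by rewrite ler_wpM2r ?sqr_ge0//; have := sqr_ge0 B; lra.
Qed.

Let g_complete : complete_form g.
Proof.
have [C C0 hC] := bT; have [B B0 hB] := bounded_abs.
apply: (@complete_form_equiv _ _ gX g e^-1 (C + `|l| * B)) => //.
- by rewrite invr_ge0 ltW.
- by rewrite addr_ge0// mulr_ge0.
- move=> x; rewrite gE mulrDl lerD//.
    by rewrite (le_trans (ler_norm _))// (le_trans (krein_abs _ hY)).
  by rewrite (le_trans (ler_norm _))// normrN normrM -mulrA ler_wpM2l.
- by case: hX.
Qed.

Let b_bounded_g : bounded_form g b.
Proof.
have [B B0 hB] := bb; exists (B * e^-1 ^+ 2) => [|x y].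
  by rewrite mulr_ge0 ?sqr_ge0.
rewrite (le_trans (hB _ _))// -mulrA ler_wpM2l//.
by rewrite expr2 mulrACA ler_pM.
Qed.

(** The centers [x] for which [g (u - x) (u - x)] is, on the cone and up to a constant, an objective
    covered by [minimum]. *)
Let S x := exists w, forall u, g u x = fY (T u) w.

(* If [b] were nonnegative on [S], hence on its [g]-closure, then, splitting
   [x] along [g] into the closure of [S] and its complement, which lies in the
   nullspace of [T] and is [b]-orthogonal to the former, [a] or [b] would be
   positive semidefinite, according to the sign of [l]. *)
Let S_neg : exists x, S x /\ b x x < 0.
Proof.
apply: contrapT => /forallNP nS.
have Sb x : S x -> 0 <= b x x.
  by move=> Sx; rewrite leNgt; apply/negP => bx; exact: nS (conj Sx bx).
have split_along x : exists2 n, T n = 0 & exists2 m, x = m + n &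
    0 <= b m m /\ b m n = 0.
  have gx s : S s -> g x s ^+ 2 <= g x x * g s s by move=> _; exact: psd_CS.
  have [|||m [u [C [Su um hm]]]] :=
    @riesz_closure _ _ g S (g x) _ g0 g_complete _ _ _ gx.
  - by exists 0 => u; rewrite !sform0r.
  - move=> t p q [v hv] [w hw]; exists (t *: v + w) => z.
    by rewrite !sformDr !sformZr hv hw.
  - by move=> t p q; rewrite sformDr sformZr.
  have gn s : S s -> g (x - m) s = 0 by move=> Ss; rewrite sformBl hm// subrr.
  (* Every functional [fY (T z) w] is [g z s] with [s] in [S], hence vanishes at [x - m]; and [fY]
     is nondegenerate. *)
  have Tn : T (x - m) = 0.
    apply: (krein_nondegenerate hY) => w; have [C' C'0 hC'] := bT.
    have hw z : fY (T z) w ^+ 2 <= gY w w * C' * e^-1 * g z z.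
      rewrite (le_trans (fgY _ _))// mulrC -!mulrA ler_wpM2l//.
      by rewrite (le_trans (hC' z))// ler_wpM2l.
    have [t p q|s hs] := riesz g0 g_complete _ hw.
      by rewrite linearP sformPl.
    by rewrite -hs sformC gn//; exists w => z; rewrite sformC hs.
  exists (x - m) => //; exists m; first by rewrite addrC subrK.
  split.
    pose bn := sform_comb (-1) b 0 b.
    suff : bn m m + 0 <= 0 by rewrite sform_combE; lra.
    apply: (@quad_limit _ _ g bn (fun=> 0) 0 u _ C 0) => //.
    - have [B B0 hB] := b_bounded_g; exists B => // p q.
      by rewrite sform_combE mul0r addr0 mulN1r sqrrN.
    - by move=> *; rewrite addr0.
    - by move=> p; rewrite expr0n /= mul0r.
    - by move=> n; rewrite sform_combE; have := Sb _ (Su n); lra.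
  have gnm : g (x - m) m = 0.
    apply: sqr_le0_eq0; apply: (@le0_rate _ (g (x - m) (x - m) * C)) => n.
    have -> : g (x - m) m = - g (x - m) (u n - m).
      by rewrite sformBr (gn (u n))// sub0r opprK.
    by rewrite sqrrN (le_trans (psd_CS _ _ g0))// -mulrA ler_wpM2l.
  apply/eqP; have /eqP := gnm; rewrite gE pullE Tn sform0l sub0r oppr_eq0.
  by rewrite mulf_eq0 (negbTE l0) sformC.
have ab n : T n = 0 -> a n n = 0 by move=> Tn; rewrite pullE Tn sform0l.
(* For [l >= 0], [a x x = a m m >= l * b m m >= 0]; for [l < 0], [g n n = - l * b n n] gives
   [b n n >= 0]. *)
have [l_ge|l_lt] := leP 0 l.
  have [x] := a_neg; have [n Tn [m -> [bm _]]] := split_along x.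
  rewrite pullE linearD Tn addr0 -pullE ltNge => /negP; apply.
  have := g0 m; rewrite gE subr_ge0; apply: le_trans.
  exact: mulr_ge0.
have [x] := b_neg; have [n Tn [m -> [bm bmn]]] := split_along x.
rewrite sformDD bmn; have := g0 n; rewrite gE ab// sub0r -mulNr.
by rewrite pmulr_rge0 ?oppr_gt0//; lra.
Qed.

Let A := [set a x x / b x x | x in [set x | 0 < b x x]].
Let mu := inf A.

Let l_lb x : 0 < b x x -> l <= a x x / b x x.
Proof. by move=> bx; rewrite ler_pdivlMr//; have := g0 x; rewrite gE; lra. Qed.

Let A_inf : has_inf A.
Proof.
have [x bx] := b_pos; split; first by exists (a x x / b x x), x.
by exists l => _ [y by0 <-]; exact: l_lb.
Qed.

Let l_mu : l <= mu.
Proof. by apply: lb_le_inf => [|_ [y by0 <-]]; [exact: A_inf.1|exact: l_lb]. Qed.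

Let mu_le x : 0 < b x x -> mu <= a x x / b x x.
Proof. by move=> bx; apply: ge_inf; [exact: A_inf.2|exists x]. Qed.

Let q := sform_comb 1 a (- mu) b.

Let qE x y : q x y = a x y - mu * b x y.
Proof. by rewrite sform_combE mul1r mulNr. Qed.

(* If the infimum is not attained, take [x] from [S_neg]: as [y] ranges over
   the cone, the infimum of [q (y - x) (y - x)] is [0], but this value forces
   [y = x], and [x] is not in the cone. *)
Lemma inf_ratio_attained : exists2 x, 0 < b x x &
  forall y, 0 < b y y -> a x x / b x x <= a y y / b y y.
Proof.
apply: contrapT => na.
have q_pos x : 0 < b x x -> 0 < q x x.
  move=> bx; rewrite ltNge; apply/negP => qx; apply: na; exists x => // y bY.
  apply: le_trans (mu_le bY); rewrite ler_pdivrMr//.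
  by move: qx; rewrite qE subr_le0.
have [x [[w0 hw0] bx]] := S_neg.
have [w hw] : exists w, forall u, q u x = fY (T u) w.
  (* Substitute in [q = g - (mu - l) b] the value of [b u x] solved from
     [l * b u x = fY (T u) (T x) - fY (T u) w0]. *)
  exists (w0 - ((mu - l) / l) *: (T x - w0)) => u.
  have h : l * b u x = fY (T u) (T x) - fY (T u) w0.
    by rewrite -hw0 gE pullE; lra.
  rewrite sformBr sformZr sformBr -h -hw0 qE gE.
  by field.
have [y y0 ymin] := minimum w.
have fq u : b u u = 0 ->
    fY (T u - w) (T u - w) = q (u - x) (u - x) - q x x + fY w w.
  by move=> u0; rewrite !sformBB -hw -pullE !qE u0; lra.
have qy : q (y - x) (y - x) <= 0.
  rewrite leNgt; apply/negP => qy.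
  (* The ratio of [v] is taken so near [mu] that [t *: v] with [t ^+ 2 * b v v <= - b x x] has a
     smaller [q] than [y - x]. *)
  have ep : 0 < q (y - x) (y - x) / - b x x by rewrite divr_gt0// oppr_gt0.
  have [_ [v bv <-]] := inf_adherent ep A_inf.
  rewrite -/mu ltr_pdivrMr// mulrDl -ltrBlDl -qE => qv.
  have [|t1 [t2 [t10 t20 tt b1 b2]]] := @isotropic_line _ _ b x v.
    by rewrite nmulr_rlt0.
  have close t : t != 0 -> t ^+ 2 * b v v <= - b x x ->
      b (x + t *: v) (x + t *: v) = 0 -> False.
    move=> tn0 ht b0; have := ymin _ b0; rewrite !fq//.
    have -> : x + t *: v - x = t *: v by rewrite addrAC subrr add0r.
    rewrite sformZZ => h.
    have : t ^+ 2 * q v v < q (y - x) (y - x).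
      apply: (@lt_le_trans _ _ (t ^+ 2 * (q (y - x) (y - x) / - b x x * b v v))).
        by rewrite ltr_pM2l// exprn_even_gt0.
      rewrite mulrCA -mulrA ger_pMr//; rewrite mulrC ler_pdivrMr ?oppr_gt0//.
      by rewrite mul1r.
    by lra.
  (* Since [t1 * t2 * b v v = b x x], the root of smaller absolute value meets the size condition of
     [close]. *)
  have [h|h] := leP (- t1) t2.
    apply: (close t1) => //; first by rewrite lt_eqF.
    rewrite -tt -mulNr ler_pM2r// expr2 -mulrN; nra.
  apply: (close t2) => //; first by rewrite gt_eqF.
  rewrite -tt -mulNr ler_pM2r// expr2; nra.
(* As [q] is positive where [b] is, [b] is nonpositive at [y - x]; then [q >= e * gX - (mu - l) * b]
   forces [y = x]. *)
have bd : b (y - x) (y - x) <= 0.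
  by rewrite leNgt; apply/negP => /q_pos; rewrite ltNge qy.
have yx : y - x = 0.
  have [_ defX _] := hX; apply: defX; apply/eqP; rewrite eq_le gX0 andbT.
  have h := coerc (y - x).
  have : e * gX (y - x) (y - x) <= q (y - x) (y - x) + (mu - l) * b (y - x) (y - x).
    by rewrite qE; lra.
  have : (mu - l) * b (y - x) (y - x) <= 0 by rewrite mulr_ge0_le0// subr_ge0.
  move=> h1 h2; rewrite -(pmulr_rle0 _ e0); lra.
by move/eqP: yx; rewrite subr_eq0 => /eqP yx; move: bx; rewrite -yx y0 ltxx.
Qed.

End Attainment.

(** * Coercivity and attainment imply existence of minima *)

Section Existence.
Variables (R : realType) (X : lmodType R).
Variables (gX a b : sform X) (l : X -> R) (D al : R) (vp vm : X).
Hypotheses (hX : hilbert gX) (ba : bounded_form gX a) (bb : bounded_form gX b).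
Hypothesis lP : forall t x y, l (t *: x + y) = t * l x + l y.
Hypothesis lD : forall x, l x ^+ 2 <= D * gX x x.
Hypothesis al0 : 0 < al.
Hypothesis coerc : forall x, b x x = 0 -> al * gX x x <= a x x.
Hypotheses (vp0 : 0 < b vp vp) (vm0 : b vm vm < 0).
Hypothesis vp_inf : forall x, 0 < b x x -> a vp vp / b vp vp <= a x x / b x x.
Hypothesis vm_sup : forall x, b x x < 0 -> a x x / b x x <= a vm vm / b vm vm.

Let gX0 : psd gX. Proof. by case: hX. Qed.

Let lp := a vp vp / b vp vp.
Let lm := a vm vm / b vm vm.
Let qp := sform_comb 1 a (- lp) b.
Let qm := sform_comb 1 a (- lm) b.

Let qpE x y : qp x y = a x y - lp * b x y.
Proof. by rewrite sform_combE mul1r mulNr. Qed.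

Let qmE x y : qm x y = a x y - lm * b x y.
Proof. by rewrite sform_combE mul1r mulNr. Qed.

Let qp_vp : qp vp vp = 0.
Proof. by rewrite qpE /lp divfK ?subrr// gt_eqF. Qed.

Let qm_vm : qm vm vm = 0.
Proof. by rewrite qmE /lm divfK ?subrr// lt_eqF. Qed.

(** The S-lemma for [a - al * gX]; its inequality at [vm] and [vp] places [mu] between [lm] and
    [lp]. *)
Let multiplier : exists2 mu, lm <= mu <= lp &
  forall x, al * gX x x <= a x x - mu * b x x.
Proof.
have [z z0|mu hmu] := @S_lemma _ _ (sform_comb 1 a (- al) gX) b
    (ex_intro _ vp vp0) (ex_intro _ vm vm0).
  by rewrite sform_combE; have := coerc z0; lra.
have h x : al * gX x x <= a x x - mu * b x x.
  by have := hmu x; rewrite sform_combE; lra.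
exists mu => //; rewrite ler_ndivrMr// ler_pdivlMr//.
have pos x : mu * b x x <= a x x.
  by have := h x; have : 0 <= al * gX x x by [rewrite mulr_ge0// ltW]; lra.
by rewrite !pos.
Qed.

(** Where [b <= 0], [lp * b <= mu * b <= a]; where [b > 0], it is the minimality of [vp]. *)
Let qp_psd : psd qp.
Proof.
have [mu /andP[hm hp] hmu] := multiplier => x; rewrite qpE subr_ge0.
have [bx|bx] := leP (b x x) 0; last by rewrite -ler_pdivlMr// vp_inf.
have : 0 <= al * gX x x by rewrite mulr_ge0// ltW.
have := hmu x; have : lp * b x x <= mu * b x x by rewrite ler_wnM2r.
by lra.
Qed.

Let qm_psd : psd qm.
Proof.
have [mu /andP[hm hp] hmu] := multiplier => x; rewrite qmE subr_ge0.
have [bx|bx] := leP 0 (b x x); last by rewrite -ler_ndivrMr// vm_sup.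
have : 0 <= al * gX x x by rewrite mulr_ge0// ltW.
have := hmu x; have : lm * b x x <= mu * b x x by rewrite ler_wpM2r.
by lra.
Qed.

Let q_bounded s : bounded_form gX (sform_comb 1 a s b).
Proof.
have [A A0 hA] := ba; have [B B0 hB] := bb.
exists (2 * A + 2 * (s ^+ 2 * B)) => [|x y].
  by have := mulr_ge0 (sqr_ge0 s) B0; lra.
rewrite sform_combE; have := hA x y; have := hB x y.
move: (a x y) (b x y) (gX x x * gX y y) => p r t hr hp.
have := sqr_ge0 (p - s * r).
have : s ^+ 2 * r ^+ 2 <= s ^+ 2 * (B * t) by rewrite ler_wpM2l ?sqr_ge0.
by lra.
Qed.

Let lD' x y : l (x + y) = l x + l y.
Proof. by have := lP 1 x y; rewrite scale1r mul1r. Qed.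

Let lZ t x : l (t *: x) = t * l x.
Proof.
have l0 : l 0 = 0 by have := lD' 0 0; rewrite addr0; lra.
by have := lP t x 0; rewrite addr0 l0 addr0.
Qed.

(* A convex function that agrees with the objective [a x x - 2 * l x] on the
   cone, and whose minimum over the whole space is attained on the cone. *)
Let M x := maxr (qp x x) (qm x x) - 2 * l x.

Let M_le x v : (M x <= v) = (qp x x - 2 * l x <= v) && (qm x x - 2 * l x <= v).
Proof. by rewrite /M !lerBlDr ge_max. Qed.

Let M_cone x : b x x = 0 -> M x = a x x - 2 * l x.
Proof. by move=> x0; rewrite /M qpE qmE x0 !mulr0 !subr0 maxxx. Qed.

Let lm_lp : lm <= lp.
Proof. by have [mu /andP[h1 h2] _] := multiplier; exact: le_trans h1 h2. Qed.

Let M_pos x : 0 <= b x x -> M x = qm x x - 2 * l x.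
Proof.
move=> bx; rewrite /M max_r// qpE qmE lerD2l lerN2.
exact: ler_wpM2r.
Qed.

Let M_neg x : b x x <= 0 -> M x = qp x x - 2 * l x.
Proof.
move=> bx; rewrite /M max_l// qpE qmE lerD2l lerN2.
exact: ler_wnM2r.
Qed.

Let M_lower : exists C, forall x, al / 2 * gX x x - C <= M x.
Proof.
have [mu /andP[hm hp] hmu] := multiplier.
pose D' := `|D| + 1; have D'0 : 0 < D' by rewrite ltr_wpDl.
exists (2 * D' / al) => x.
(* As [mu] lies between [lm] and [lp], the maximum in [M] dominates the coercive [a - mu b]. *)
have h1 : al * gX x x - 2 * l x <= M x.
  rewrite /M lerD2r le_max qpE qmE; have := hmu x.
  have [bx|bx] := leP 0 (b x x).
    have : lm * b x x <= mu * b x x by rewrite ler_wpM2r.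
    by move=> h1 h2; apply/orP; right; lra.
  have : lp * b x x <= mu * b x x by rewrite ler_wnM2r// ltW.
  by move=> h1 h2; apply/orP; left; lra.
apply: le_trans h1.
have h2 : l x ^+ 2 <= D' * gX x x.
  by rewrite (le_trans (lD x))// ler_wpM2r// /D'; have := ler_norm D; lra.
(* This scale keeps [s * l x ^+ 2] within half of the coercive term, and [s^-1] is the constant
   [2 * D' / al]. *)
pose s := al / (2 * D').
have s0 : 0 < s by rewrite divr_gt0// mulr_gt0.
have h3 : s * l x ^+ 2 <= al / 2 * gX x x.
  rewrite (@le_trans _ _ (s * (D' * gX x x)))// ?ler_pM2l//.
  by rewrite /s le_eqVlt; apply/orP; left; apply/eqP; field; rewrite gt_eqF.
have h4 : 2 * l x <= s * l x ^+ 2 + 2 * D' / al.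
  have : 0 <= s * (l x - s^-1) ^+ 2 by rewrite mulr_ge0 ?sqr_ge0// ltW.
  have -> : s * (l x - s^-1) ^+ 2 = s * l x ^+ 2 - 2 * l x + s^-1.
    by field; rewrite gt_eqF.
  by rewrite [X in _ + X](_ : _ = 2 * D' / al) ?/s ?invf_div//; lra.
by lra.
Qed.

Let mid_le (q : sform X) v x y : psd q ->
  q x x - 2 * l x <= v -> q y y - 2 * l y <= v ->
  q (2^-1 *: (x + y)) (2^-1 *: (x + y)) - 2 * l (2^-1 *: (x + y)) <= v.
Proof.
move=> q0; rewrite sformZZ sformDD lZ lD'; have := q0 (x - y).
by rewrite sformBB; lra.
Qed.

Let limit_le s (u : nat -> X) x C m :
  (forall n, gX (u n - x) (u n - x) <= C * rate R n) ->
  (forall n, sform_comb 1 a s b (u n) (u n) - 2 * l (u n) <= m + rate R n) ->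
  sform_comb 1 a s b x x - 2 * l x <= m.
Proof.
move=> uC um.
apply: (@quad_limit _ _ gX _ (fun x => - (2 * l x)) (4 * D) u x C 1 m) => //.
- by move=> p r; rewrite lD'; ring.
- by move=> p; rewrite sqrrN exprMn; have := lD p; lra.
- by move=> n; rewrite mul1r.
Qed.

Let M_min : exists x, forall y, M x <= M y.
Proof.
have [_ _ cX] := hX; have [C hC] := M_lower.
apply: (convex_min gX0 cX).
- exists (- C) => x; apply: le_trans (hC x).
  by rewrite lerDr mulr_ge0 ?divr_ge0// ltW.
- move=> v; exists ((v + C) / (al / 2)) => x /(le_trans (hC x)) h.
  rewrite ler_pdivlMr ?divr_gt0// mulrC; lra.
- move=> v x y; rewrite !M_le => /andP[h1 h2] /andP[h3 h4].
  by rewrite !mid_le.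
- move=> u x C' m uC; rewrite M_le => h; apply/andP; split.
    by apply: limit_le uC _ => n; have := h n; rewrite M_le => /andP[].
  by apply: limit_le uC _ => n; have := h n; rewrite M_le => /andP[].
Qed.

(* [M] is constant along the line through the minimizer directed by a
   null vector [v] of [q], up to the cone. *)
Let move_to_cone (q : sform X) v x : q v v = 0 -> b x x * b v v < 0 ->
  M x = q x x - 2 * l x -> (forall y, b y y = 0 -> M y = q y y - 2 * l y) ->
  (forall y, M x <= M y) -> exists2 y, b y y = 0 & M y = M x.
Proof.
move=> qv xv Mx My xmin.
have [t1 [t2 [t10 t20 _ b1 b2]]] := isotropic_line xv.
have line t : b (x + t *: v) (x + t *: v) = 0 ->
    M (x + t *: v) = M x + 2 * t * (q x v - l v).
  by move=> bt; rewrite My// Mx sformDD sformZZ sformZr qv lD' lZ; ring.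
have := xmin (x + t1 *: v); have := xmin (x + t2 *: v).
rewrite !line// !lerDl => h2 h1; exists (x + t1 *: v) => //; rewrite line//.
(* The change [2 * t * (q x v - l v)] of [M] is nonnegative at roots of both signs, so the slope
   vanishes. *)
suff -> : q x v - l v = 0 by rewrite mulr0 addr0.
have t20' : 0 < 2 * t2 by rewrite pmulr_rgt0.
have t10' : 2 * t1 < 0 by rewrite pmulr_rlt0.
by apply/eqP; rewrite eq_le -(nmulr_rge0 _ t10') h1 -(pmulr_rge0 _ t20').
Qed.

Lemma cone_minimum : exists2 y, b y y = 0 &
  forall x, b x x = 0 -> a y y - 2 * l y <= a x x - 2 * l x.
Proof.
have [x xmin] := M_min.
suff [y y0 yx] : exists2 y, b y y = 0 & M y = M x.
  by exists y => // z z0; rewrite -!M_cone// yx.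
have [bx|bx|bx] := ltgtP (b x x) 0; last by exists x.
  apply: (@move_to_cone qp vp) => //; first by rewrite nmulr_rlt0.
    by rewrite M_neg// ltW.
  by move=> y y0; rewrite M_neg// y0.
apply: (@move_to_cone qm vm) => //; first by rewrite pmulr_rlt0.
  by rewrite M_pos// ltW.
by move=> y y0; rewrite M_pos// y0.
Qed.

End Existence.

(** * Complex spaces as real spaces *)

Section Realification.
Variable R : realType.

(** An alias, so that the restriction of scalars to [R] does not clash with the complex structure of
    [U]. *)
Definition realspace (U : lmodType R[i]) : Type := U.

HB.instance Definition _ (U : lmodType R[i]) := GRing.Zmodule.on (realspace U).

Section RealSpace.
Variable U : lmodType R[i].

Definition real_scale (t : R) (x : realspace U) : realspace U :=
  (t%:C)%C *: (x : U).

Fact real_scaleA s t x : real_scale s (real_scale t x) = real_scale (s * t) x.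
Proof. by rewrite /real_scale scalerA rmorphM. Qed.

Fact real_scale1 : left_id 1 real_scale.
Proof. by move=> x; rewrite /real_scale rmorph1 scale1r. Qed.

Fact real_scaleDr : right_distributive real_scale +%R.
Proof. by move=> t x y; rewrite /real_scale scalerDr. Qed.

Fact real_scaleDl x : {morph real_scale^~ x : s t / s + t}.
Proof. by move=> s t; rewrite /real_scale rmorphD scalerDl. Qed.

HB.instance Definition _ := GRing.Zmodule_isLmodule.Build R (realspace U)
  real_scaleA real_scale1 real_scaleDr real_scaleDl.

Lemma real_scaleE (t : R) (x : realspace U) : t *: x = (t%:C)%C *: (x : U).
Proof. by []. Qed.

Variable f : {hermitian_sym U for conjC}.

Lemma Re_conjC (z : R[i]) : complex.Re (conjC z) = complex.Re z.
Proof. by case: z. Qed.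

Lemma herm_conj x y : f x y = conjC (f y x).
Proof. by rewrite hermC expr0 mul1r. Qed.

Fact real_form_symm (x y : realspace U) : complex.Re (f x y) = complex.Re (f y x).
Proof. by rewrite herm_conj Re_conjC. Qed.

Fact real_form_lin (t : R) (x y z : realspace U) :
  complex.Re (f (t *: x + y) z) = t * complex.Re (f x z) + complex.Re (f y z).
Proof.
rewrite real_scaleE linearPl /=; case: (f x z) => p q; case: (f y z) => r s /=.
by rewrite mul0r subr0.
Qed.

Definition real_form : sform (realspace U) := SForm real_form_symm real_form_lin.

Lemma real_formE x : f x x = ((real_form x x)%:C)%C.
Proof.
have := herm_conj x x; rewrite /=; case: (f x x) => p q /= [] /eqP.
by rewrite -addr_eq0 -mulr2n mulrn_eq0 /= => /eqP ->.
Qed.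

End RealSpace.

Section RealMap.
Variables (U W : lmodType R[i]) (T : {linear U -> W}).

Definition real_map : realspace U -> realspace W := T.

Fact real_map_linear : linear real_map.
Proof. by move=> t x y; rewrite /real_map !real_scaleE linearP. Qed.

HB.instance Definition _ :=
  GRing.isLinear.Build R (realspace U) (realspace W) _ real_map real_map_linear.

End RealMap.

Lemma hilbert_norm (U : completeNormedModType R[i]) (g : sform (realspace U)) :
  (forall x : U, `|x| ^+ 2 = ((g x x)%:C)%C) -> hilbert g.
Proof.
move=> gn; have g0 : psd g.
  by move=> x; rewrite -ler0c -gn exprn_ge0.
split => //.
  move=> x gx; have := gn x; rewrite gx => /eqP.
  by rewrite expf_eq0 /= normr_eq0 => /eqP.
move=> u C uC.
have small e : 0 < e -> exists N, forall m n, (N <= m)%N -> (N <= n)%N ->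
    `|(u m : U) - u n| < (e%:C)%C.
  move=> e0; have [N hN] := rate_small (2 * `|C|) (exprn_gt0 2 e0).
  exists N => m n Nm Nn.
  rewrite -(@ltr_pXn2r _ 2)// ?nnegrE ?normr_ge0 ?ler0c ?(ltW e0)//.
  rewrite gn -rmorphXn ltcR (le_lt_trans (uC m n))// (le_lt_trans _ hN)//.
  have := rate_anti R Nm; have := rate_anti R Nn; have := ler_norm C.
  have := rate_gt0 R m; have := rate_gt0 R n.
  move=> m0 n0 CC h1 h2; apply: (@le_trans _ _ (`|C| * (rate R m + rate R n))).
    by rewrite ler_wpM2r// addr_ge0// ltW.
  have : `|C| * (rate R m + rate R n) <= `|C| * (2 * rate R N).
    by rewrite ler_wpM2l//; lra.
  by lra.
have /cvg_ex[x ux] : cvg ((u : nat -> U) @ \oo).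
  apply/cauchy_cvgP/cauchy_exP => e e0.
  have eR : e = ((complex.Re e)%:C)%C by rewrite RRe_real// gtr0_real.
  have e0' : 0 < complex.Re e by rewrite -ltcR -eR.
  have [N hN] := small _ e0'; exists (u N), N => // n /= Nn.
  by rewrite -ball_normE /= eR; exact: hN.
exists x, (4 * `|C| + 2) => n.
have r0 := rate_gt0 R n; have r1 := rate_le1 R n.
have er : (0 : R[i]) < ((rate R n)%:C)%C by rewrite ltcR.
have [N _ hN] := (cvgrPdist_lt _ _).1 ux _ er.
(* [m >= N] brings [u m] within [rate R n] of [x], and [m >= n] bounds its distance to [u n] by the
   Cauchy hypothesis. *)
pose m := maxn n N.
have h1 : g (x - u m) (x - u m) <= rate R n ^+ 2.
  rewrite -lecR -gn rmorphXn /= lerXn2r ?nnegrE ?normr_ge0 ?ler0c ?(ltW r0)//.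
  by apply: ltW; apply: hN; rewrite /= leq_maxr.
have := psd_suble (u n) x (u m) g0; have := uC n m.
have : C * (rate R n + rate R m) <= `|C| * (2 * rate R n).
  rewrite (@le_trans _ _ (`|C| * (rate R n + rate R m)))//.
    by rewrite ler_wpM2r ?ler_norm// addr_ge0// ltW// rate_gt0.
  by rewrite ler_wpM2l//; have := rate_anti R (leq_maxl n N); rewrite -/m; lra.
have : rate R n ^+ 2 <= rate R n by rewrite expr2 ler_piMl// ltW.
by lra.
Qed.

End Realification.

(** * The Hilbert space form associated with a Krein space *)

Section KreinReal.
Variables (R : realType) (U : completeNormedModType R[i]).
Variable f : {hermitian_sym U for conjC}.

(** [g] is [f] with its sign changed on the negative part; the projections [p] and [m] are linear
    because the decomposition is unique. *)
Lemma krein_real : krein_space f -> exists2 g : sform (realspace U),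
  krein g (real_form f) & forall x : U, `|x| ^+ 2 = ((g x x)%:C)%C.
Proof.
move=> [Up [Um [[[Up0 UpP] [Um0 UmP]] UI UD Uo Un]]].
have upP c x y : Up x -> Up y -> Up (c *: x + y).
  by move=> hx hy; apply/set_mem/UpP; exact/mem_set.
have umP c x y : Um x -> Um y -> Um (c *: x + y).
  by move=> hx hy; apply/set_mem/UmP; exact/mem_set.
have up0 : Up 0 by apply/set_mem.
have um0 : Um 0 by apply/set_mem.
have umN x : Um x -> Um (- x).
  by move=> hx; have := umP (-1) x 0 hx um0; rewrite scaleN1r addr0.
have unique xp xm yp ym : Up xp -> Um xm -> Up yp -> Um ym ->
    xp + xm = yp + ym -> xp = yp /\ xm = ym.
  move=> h1 h2 h3 h4 e; have e' : xp - yp = ym - xm.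
    by apply/eqP; rewrite subr_eq addrAC eq_sym subr_eq (addrC ym) e.
  have : [set 0] (xp - yp).
    rewrite -UI; split; first by rewrite addrC -scaleN1r; exact: upP.
    by rewrite e' addrC -scaleN1r; exact: umP.
  move=> /= d0; split; apply/eqP; first by rewrite -subr_eq0 d0.
  by rewrite eq_sym -subr_eq0 -e' d0.
have /choice[p hp] x : exists xp, Up xp /\ exists2 xm, Um xm & x = xp + xm.
  by have [xp [xm [h1 h2 h3]]] := UD x; exists xp; split => //; exists xm.
pose m x := x - p x.
have pm x : x = p x + m x by rewrite addrC subrK.
have pU x : Up (p x) by case: (hp x).
have mU x : Um (m x).
  by have [_ [xm h e]] := hp x; rewrite /m {1}e addrAC subrr add0r.
clearbody m.
have pmE x xp xm : Up xp -> Um xm -> x = xp + xm -> p x = xp /\ m x = xm.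
  by move=> h1 h2 e; apply: unique => //; rewrite -pm.
have pmP c x y : p (c *: x + y) = c *: p x + p y /\ m (c *: x + y) = c *: m x + m y.
  apply: pmE; [exact: upP|exact: umP|].
  by rewrite addrACA -scalerDr -!pm.
have pL : linear (p : realspace U -> realspace U).
  by move=> t x y; rewrite !real_scaleE (pmP _ _ _).1.
have mL : linear (m : realspace U -> realspace U).
  by move=> t x y; rewrite !real_scaleE (pmP _ _ _).2.
pose P : {linear realspace U -> realspace U} :=
  HB.pack (p : realspace U -> realspace U) (GRing.isLinear.Build _ _ _ _ _ pL).
pose M : {linear realspace U -> realspace U} :=
  HB.pack (m : realspace U -> realspace U) (GRing.isLinear.Build _ _ _ _ _ mL).
pose F := real_form f.
pose g := sform_comb 1 (pull F P) (-1) (pull F M).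
have gE x y : g x y = F (p x) (p y) - F (m x) (m y).
  by rewrite sform_combE mul1r mulN1r.
have gn (x : U) : `|x| ^+ 2 = ((g x x)%:C)%C.
  by rewrite gE {1}(pm x) Un// rmorphB /= !real_formE.
have hg := hilbert_norm gn; have [g0 _ _] := hg.
have F0 xp xm : Up xp -> Um xm -> F xp xm = 0.
  by move=> h1 h2; rewrite /F /= Uo.
have FE x y : F x y = F (p x) (p y) + F (m x) (m y).
  rewrite {1}(pm x) {1}(pm y) sformDl !sformDr (F0 (p x) (m y))//.
  by rewrite (sformC F (m x) (p y)) (F0 (p y) (m x))// addr0 add0r.
(* The fundamental symmetry, a [g]-isometric involution; [F x y = g x (J y)] gives the two remaining
   Krein conditions. *)
pose J y := p y - m y.
have pmJ y : p (J y) = p y /\ m (J y) = - m y by apply: pmE => //; exact: umN.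
have JE x y : F x y = g x (J y).
  by rewrite gE (pmJ _).1 (pmJ _).2 sformNr opprK FE.
exists g => //; split => // [x y|y].
  rewrite JE (le_trans (psd_CS _ _ g0))// ler_wpM2l//.
  by rewrite !gE (pmJ _).1 (pmJ _).2 sformNl sformNr opprK.
exists (J y) => x; rewrite JE; congr (g x _).
by rewrite {1}/J (pmJ _).1 (pmJ _).2 opprK -pm.
Qed.

End KreinReal.

(** * Attained extrema, bounded operators and adjoints in real terms *)

Lemma sup_attainedP (R : realType) (X : Type) (A : set X) (g : X -> R) :
  sup_attained A g <-> exists2 x, A x & forall y, A y -> g y <= g x.
Proof.
split=> -[x Ax hx]; exists x => //.
  move=> y Ay; rewrite -lee_fin hx; apply: ereal_sup_ubound.
  by exists y.
apply/eqP; rewrite eq_le; apply/andP; split.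
  by apply: ereal_sup_ubound; exists x.
by apply: ge_ereal_sup => _ [y Ay <-]; rewrite lee_fin hx.
Qed.

Lemma inf_attainedP (R : realType) (X : Type) (A : set X) (g : X -> R) :
  inf_attained A g <-> exists2 x, A x & forall y, A y -> g x <= g y.
Proof.
split=> -[x Ax hx]; exists x => //.
  move=> y Ay; rewrite -lee_fin hx; apply: ereal_inf_lbound.
  by exists y.
apply/eqP; rewrite eq_le; apply/andP; split; last first.
  by apply: ereal_inf_lbound; exists x.
by apply: le_ereal_inf_tmp => _ [y Ay <-]; rewrite lee_fin hx.
Qed.

Lemma real_bounded (R : realType) (U W : completeNormedModType R[i])
    (gU : sform (realspace U)) (gW : sform (realspace W)) (T : {linear U -> W}) :
  (forall x : U, `|x| ^+ 2 = ((gU x x)%:C)%C) ->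
  (forall x : W, `|x| ^+ 2 = ((gW x x)%:C)%C) -> bounded_operator T ->
  exists2 C, 0 <= C & forall x, gW (real_map T x) (real_map T x) <= C * gU x x.
Proof.
move=> hU hW [M hM]; exists (M ^+ 2) => [|x]; first exact: sqr_ge0.
rewrite -lecR rmorphM rmorphXn /= -hU -[X in X <= _]hW -exprMn.
by rewrite lerXn2r ?nnegrE// (le_trans _ (hM x)).
Qed.

(** The adjoint is given as a bare function; the adjoint identity and definiteness of [ip] force its
    linearity. *)
Lemma real_adjoint (R : realType) (H K : completeNormedModType R[i])
    (ip : {dot H for conjC}) (f : {hermitian_sym K for conjC})
    (T : {linear H -> K}) (Ts : K -> H) :
  definite (real_form ip) -> is_adjoint ip f T Ts ->
  exists2 Tr : {linear realspace K -> realspace H}, Tr =1 Ts &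
  forall x w, real_form f (real_map T x) w = real_form ip x (Tr w).
Proof.
move=> dip adj.
have adj' x w : real_form f (real_map T x) w = real_form ip x (Ts w).
  by rewrite /= adj.
have L : linear (Ts : realspace K -> realspace H).
  move=> t u v; apply/eqP; rewrite -subr_eq0; apply/eqP; apply: dip.
  have h x :
      real_form ip x (Ts (t *: u + v) - (t *: (Ts u : realspace H) + Ts v)) = 0.
    by rewrite sformBr sformDr sformZr -!adj' sformDr sformZr subrr.
  exact: h.
pose Tr : {linear realspace K -> realspace H} :=
  HB.pack (Ts : realspace K -> realspace H) (GRing.isLinear.Build _ _ _ _ _ L).
by exists Tr.
Qed.

(** * The equivalence, by transfer to the real forms *)

Theorem theorem4p10 (R : realType) (H K E : completeNormedModType R[i])
  (ip : {dot H for conjC})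
  (fK : {hermitian_sym K for conjC}) (fE : {hermitian_sym E for conjC})
  (T : {linear H -> K}) (V : {linear H -> E}) (Ts : K -> H) (Vs : E -> H)
  (hH : hilbert_space ip) (sepH : separable H)
  (hK : krein_space fK) (hE : krein_space fE)
  (bT : bounded_operator T) (clT : closed (range T))
  (bV : bounded_operator V) (surjV : range V = [set: E])
  (adjT : is_adjoint ip fK T Ts) (adjV : is_adjoint ip fE V Vs)
  (indT : indefinite ip (Ts \o T)) (indV : indefinite ip (Vs \o V))
  (kerTV : nullspace T `&` nullspace V = [set 0]) :
  (forall (w : K) (z : E), Z_set fK fE T V w z !=set0) <->
  [/\ (exists2 alpha : R, 0 < alpha &
         forall y, C_set fE V y -> alpha%:C%C * `|y| ^+ 2 <= fK (T y) (T y)),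
      sup_attained (P_minus fE V) (quotient fK fE T V) &
      inf_attained (P_plus fE V) (quotient fK fE T V)].
Proof.
pose gH := real_form ip.
have gHn (x : H) : `|x| ^+ 2 = ((gH x x)%:C)%C by rewrite hH real_formE.
have hilH : hilbert gH := hilbert_norm gHn; have [gH0 dH _] := hilH.
have [gK kK gKn] := krein_real hK.
have [gE kE gEn] := krein_real hE.
have rbT := real_bounded gHn gKn bT; have rbV := real_bounded gHn gEn bV.
have [rTs TsE radjT] := real_adjoint dH adjT.
have [rVs VsE radjV] := real_adjoint dH adjV.
pose rT := real_map T; pose rV := real_map V.
pose FK := real_form fK; pose FE := real_form fE.
pose a := pull FK rT; pose b := pull FE rV.
have aE x : fK (T x) (T x) = ((a x x)%:C)%C by rewrite real_formE.
have bE x : fE (V x) (V x) = ((b x x)%:C)%C by rewrite real_formE.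
have adjE (W : completeNormedModType R[i]) (f : {hermitian_sym W for conjC})
    (S : {linear H -> W}) Ss x : is_adjoint ip f S Ss ->
    ip (Ss (S x)) x = f (S x) (S x).
  by move=> adj; rewrite (herm_conj f) adj; exact: herm_conj.
have [a_neg b_neg b_pos] : [/\ exists x, a x x < 0, exists x, b x x < 0 &
    exists x, 0 < b x x].
  case: indT indV => [/existsNP[x hx] _] [/existsNP[y hy] /existsNP[z hz]].
  split; [exists x|exists y|exists z].
  - rewrite ltNge; apply/negP => h; apply: hx.
    by rewrite /= (adjE _ _ _ _ _ adjT) aE ler0c.
  - rewrite ltNge; apply/negP => h; apply: hy.
    by rewrite /= (adjE _ _ _ _ _ adjV) bE ler0c.
  - rewrite ltNge; apply/negP => h; apply: hz.
    by rewrite /= (adjE _ _ _ _ _ adjV) bE lecR.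
have surj w : exists x, rV x = w.
  have : range V w by rewrite surjV.
  by move=> [x _ <-]; exists x.
have CE y : C_set fE V y <-> b y y = 0.
  by rewrite /C_set mksetE bE; split=> [/(@complexI R _ 0)|h]//; rewrite h.
have Pp y : P_plus fE V y <-> 0 < b y y by rewrite /P_plus /= bE ltcR.
have Pm y : P_minus fE V y <-> b y y < 0 by rewrite /P_minus /= bE ltcR.
have qE y : quotient fK fE T V y = a y y / b y y.
  by rewrite /quotient aE bE -fmorph_div.
have Z_min : (forall w z, Z_set fK fE T V w z !=set0) <->
    forall w, exists2 y, b y y = 0 & forall x, b x x = 0 ->
      FK (rT y - w) (rT y - w) <= FK (rT x - w) (rT x - w).
  split=> [Z w|min w z].
    have [y [y0 ymin]] := Z w 0; exists y.
      by apply/CE; rewrite /C_set /= -[V y]subr0.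
    move=> x x0; rewrite -lecR -!real_formE; apply: ymin.
    by rewrite /constraint_set /= subr0; apply/CE.
  have [x0 xz] : exists x0, V x0 = z := surj z.
  have [y y0 ymin] := min (w - T x0).
  have TE u : T (u + x0) - w = T u - (w - T x0) by rewrite (linearD T) opprB addrA.
  exists (y + x0); split.
    by rewrite /constraint_set mksetE (linearD V) -xz addrK; exact/CE.
  move=> x; rewrite /constraint_set mksetE -xz -(linearB V) => /CE xx0.
  have := ymin _ xx0; rewrite -lecR -!real_formE TE.
  by rewrite -[in T x - w](subrK x0 x) TE.
split=> [/Z_min min|[[al al0 coerc] /sup_attainedP sup /inf_attainedP inf]].
  have ker x : rT x = 0 -> rV x = 0 -> x = 0.
    by move=> hT hV; have : [set 0] x by rewrite -kerTV.
  have [e [l [e0 l0 hl]]] := coercive hilH kK kE rbT rbV radjT radjV surj ker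
    a_neg b_pos b_neg min.
  have bb := pull_bounded kE rbV.
  (* The supremum of [a / b] over [b < 0] is minus the infimum of [a / bn] over [bn > 0], with
     multiplier [- l]. *)
  pose bn := sform_comb (-1) b 0 b.
  have bnE x y : bn x y = - b x y by rewrite sform_combE mul0r addr0 mulN1r.
  split.
  - exists e => // y /CE y0; rewrite gHn aE -rmorphM /= lecR.
    by have := hl y; rewrite -/a -/b y0 mulr0 subr0.
  - apply/sup_attainedP.
    have bbn : bounded_form gH bn.
      have [B B0 hB] := bb; exists B => // x y.
      by rewrite bnE sqrrN; exact: hB.
    have [|||||x bx xmin] := inf_ratio_attained hilH kK rbT bbn a_neg _ _ _ e0
      (_ : - l != 0).
    + by have [x bx] := b_neg; exists x; rewrite bnE oppr_gt0.
    + by have [x bx] := b_pos; exists x; rewrite bnE oppr_lt0.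
    + move=> w; have [y y0 ymin] := min w; exists y; first by rewrite bnE y0 oppr0.
      by move=> x; rewrite bnE => /eqP; rewrite oppr_eq0 => /eqP; exact: ymin.
    + by rewrite oppr_eq0.
    + by move=> x; rewrite bnE mulrNN; exact: hl.
    exists x; first by apply/Pm; rewrite -oppr_gt0 -bnE.
    move=> y /Pm y0; rewrite !qE -lerN2 -!mulrN -!invrN -!bnE.
    by apply: xmin; rewrite bnE oppr_gt0.
  - apply/inf_attainedP.
    have [x bx xmin] :=
      inf_ratio_attained hilH kK rbT bb a_neg b_pos b_neg min e0 l0 hl.
    exists x; first exact/Pp.
    by move=> y /Pp y0; rewrite !qE; exact: xmin.
apply/Z_min => w.
have [vm /Pm vm0 vmsup] := sup; have [vp /Pp vp0 vpinf] := inf.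
have [C C0 hC] := rbT; have [[gK0 _ _] fgK _] := kK.
have lP t x y : FK (rT (t *: x + y)) w = t * FK (rT x) w + FK (rT y) w.
  by rewrite /rT linearP sformPl.
have lD x : FK (rT x) w ^+ 2 <= gK w w * C * gH x x.
  by rewrite (le_trans (fgK _ _))// mulrC -mulrA ler_wpM2l.
(* Up to the constant [FK w w], the objective is [a x x - 2 * FK (rT x) w]. *)
have [|||y y0 ymin] := cone_minimum hilH (pull_bounded kK rbT)
  (pull_bounded kE rbV) lP lD al0 _ vp0 vm0.
- by move=> x x0; rewrite -lecR rmorphM /= -gHn -real_formE; apply: coerc; apply/CE.
- by move=> x /Pp x0; rewrite -!qE; apply: vpinf.
- by move=> x /Pm x0; rewrite -!qE; apply: vmsup.
exists y => // x x0; have := ymin x x0.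
by rewrite !sformBB !pullE; lra.
Qed.
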